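(* Let $\mathcal G$ be a finite groupoid, $\mathcal H,\mathcal K$ a match pair of subgroupoids of $\mathcal G$, and $I=I_{\mathcal H,\mathcal K}$ the associated multiplicative partial isometry on $l^2(\mathcal G)\otimes l^2(\mathcal G)$. Then $I$ is regular, and the $C^*$-algebra $S=\{(\omega\otimes i)(I)\}$ (resp. $\hat S=\{(i\otimes\omega)(I)\}$), $\omega$ ranging over linear forms on $\mathcal L(l^2(\mathcal G))$, is isomorphic to the crossed product $C(\mathcal K)\ltimes_{\gamma^{\mathcal K}}C(\mathcal H)$ (resp. $C(\mathcal K)\rtimes_{\delta^{\mathcal H}}C(\mathcal H)$). Hence $C(\mathcal K)\rtimes_{\delta^{\mathcal H}}C(\mathcal H)$ and $C(\mathcal K)\ltimes_{\gamma^{\mathcal K}}C(\mathcal H)$ have weak Hopf $C^*$-algebra structures in duality (transported from the structures of $\hat S$ and $S$).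
   Context: Groupoid conventions: $\mathcal G^0$ units, $s$ source, $r$ range, $xy$ defined iff $s(x)=r(y)$. Subgroupoids $\mathcal H,\mathcal K$ form a match pair if $\mathcal G=\{hk:h\in\mathcal H,k\in\mathcal K,s(h)=r(k)\}$ and $\mathcal H\cap\mathcal K\subset\mathcal G^0$. Each $g\in\mathcal G$ is then uniquely $g=p_1(g)p_2(g)$, $p_1(g)\in\mathcal H,p_2(g)\in\mathcal K$; put $m=s\circ p_1=r\circ p_2$. Also $N=C(\mathcal G^0)$, and $\alpha(n)$ is multiplication by $n\circ m$ on $l^2(\mathcal G)$. The map $I=I_{\mathcal H,\mathcal K}$ on $l^2(\mathcal G\times\mathcal G)$ is $I(f)(x,y)=f(xp_1(p_2(x)^{-1}y),p_2(x)^{-1}y)$ if $m(x)=r(y)$, and $0$ otherwise. It is a partial isometry satisfying the pentagon relation $I_{12}I_{13}I_{23}=I_{23}I_{12}$ (a multiplicative partial isometry over the base $C(\mathcal G^0)$). It is called regular if $\{(i\otimes\omega)(\Sigma I)\}=\alpha(N)'$, where $\Sigma$ is the flip and $\omega$ runs over linear forms on $\mathcal L(l^2(\mathcal G))$; equivalently, the algebras $S,\hat S$ are von Neumann subalgebras of $\mathcal L(l^2(\mathcal G))$. In that case $S$ and $\hat S$ are weak Hopf $C^*$-algebras with $\Gamma(x)=I(x\otimes1)I^*$, $\kappa((\omega\otimes i)(I))=(\omega\otimes i)(I^* )$, $\epsilon((\omega\otimes i)(I))=\omega(1)$ on $S$, and $\hat\Gamma(x)=I^*(1\otimes x)I$,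 $\hat\kappa((i\otimes\omega)(I))=(i\otimes\omega)(I^* )$, $\hat\epsilon((i\otimes\omega)(I))=\omega(1)$ on $\hat S$, in duality via $\langle(\omega\otimes i)(I),(i\otimes\omega')(I)\rangle=(\omega\otimes\omega')(I)$. Weak Hopf $C^*$-algebra $(A,\Gamma,\kappa,\epsilon)$: a finite-dimensional $C^*$-algebra $A$; a (not necessarily unital) coassociative $*$-homomorphism $\Gamma:A\to A\otimes A$; a linear anti-multiplicative $\kappa:A\to A$ with $(\kappa\circ * )^2=i$, $(\kappa\otimes\kappa)\Gamma=\varsigma\Gamma\kappa$ ($\varsigma$ the flip) and $(\mathrm{mult}(\kappa\otimes i)\otimes i)(\Gamma\otimes i)\Gamma(x)=(1\otimes x)\Gamma(1)$, where $\mathrm{mult}(a\otimes b)=ab$; and a positive linear form $\epsilon$ with $(\epsilon\otimes i)\Gamma=(i\otimes\epsilon)\Gamma=i$ and $(\epsilon\otimes\epsilon)((x\otimes1)\Gamma(1)(1\otimes y))=\epsilon(xy)$. Actions: for $k\in\mathcal K,h\in\mathcal H$ with $s(k)=r(h)$, write uniquely $kh=(k\triangleright h)(k\triangleleft h)$ with $k\triangleright h\in\mathcal H$, $k\triangleleft h\in\mathcal K$. Then $\triangleright$ is a left action of $\mathcal K$ on $\mathcal H$ (fibered by $r$), with associated left action $\gamma^{\mathcal K}$ of $C(\mathcal K)$ on $C(\mathcal H)$, and $\triangleleft$ is a right action of $\mathcal H$ on $\mathcal K$ (fibered by $s$), with associated right action $\delta^{\mathcal H}$ of $C(\mathcal H)$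 on $C(\mathcal K)$. Crossed products. (i) $C(\mathcal K)\rtimes_{\delta^{\mathcal H}}C(\mathcal H)$ is the image under $R^\delta$ of the $*$-algebra of functions on $\mathcal K\,{}_s\!\times_r\mathcal H=\{(k,h):s(k)=r(h)\}$ with $F\star_\delta F'(k,h)=\sum_{r(h')=r(h)}F(k,h')F'(k\triangleleft h',h'^{-1}h)$ and $F^{\#}(k,h)=\overline{F(k\triangleleft h,h^{-1})}$, where $R^\delta$ acts on $l^2(\mathcal K\,{}_s\!\times_r\mathcal H)$ by $R^\delta(F)\xi(k,h)=\sum_{r(h')=s(h)}F(k\triangleleft h,h')\xi(k,hh')$. (ii) $C(\mathcal K)\ltimes_{\gamma^{\mathcal K}}C(\mathcal H)$ is the image under $L^\gamma$ of the $*$-algebra of functions on $\mathcal H\,{}_r\!\times_r\mathcal K=\{(h,k):r(h)=r(k)\}$ with $F\star_\gamma F'(h,k)=\sum_{r(k')=r(k)}F(h,k')F'(k'^{-1}\triangleright h,k'^{-1}k)$ and $F^{\#}(h,k)=\overline{F(k^{-1}\triangleright h,k^{-1})}$, where $L^\gamma$ acts on $l^2(\{(h,k):r(h)=s(k)\})$ by $L^\gamma(F)\xi(h,k)=\sum_{r(k')=r(k)}F(k\triangleright h,k')\xi(h,k'^{-1}k)$. In these sums $h'\in\mathcal H$ and $k'\in\mathcal K$. *)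

(* Defs.v *)
From HB Require Import structures.
From mathcomp Require Import all_boot all_order all_algebra.

Set Implicit Arguments.
Unset Strict Implicit.
Unset Printing Implicit Defensive.

Import Order.TTheory GRing.Theory Num.Theory.
Local Open Scope ring_scope.

(* The unit space is a type [gobj] of its own, embedded in the arrows by
   [gunit]; [gmul] is total, but only constrained on composable pairs, those
   with [src x = rng y]. *)
Record groupoid := Groupoid {
  gobj : finType;
  garr :> finType;
  src : garr -> gobj;
  rng : garr -> gobj;
  gunit : gobj -> garr;
  gmul : garr -> garr -> garr;
  ginv : garr -> garr;
  src_unit : forall u, src (gunit u) = u;
  rng_unit : forall u, rng (gunit u) = u;
  src_mul : forall x y, src x = rng y -> src (gmul x y) = src y;
  rng_mul : forall x y, src x = rng y -> rng (gmul x y) = rng x;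
  gmulA : forall x y z, src x = rng y -> src y = rng z ->
    gmul x (gmul y z) = gmul (gmul x y) z;
  gmul1l : forall x, gmul (gunit (rng x)) x = x;
  gmul1r : forall x, gmul x (gunit (src x)) = x;
  src_inv : forall x, src (ginv x) = rng x;
  rng_inv : forall x, rng (ginv x) = src x;
  gmulVl : forall x, gmul (ginv x) x = gunit (src x);
  gmulVr : forall x, gmul x (ginv x) = gunit (rng x)
}.

Notation "x ** y" := (gmul x y) (at level 40, left associativity).

Section MatchPair.
Variable G : groupoid.
Implicit Types A H K : {set G}.

Definition subgroupoid A : Prop :=
  (forall x y, x \in A -> y \in A -> src x = rng y -> x ** y \in A) /\
  (forall x, x \in A -> ginv x \in A).

Definition match_pair H K : Prop :=
  [/\ subgroupoid H, subgroupoid K,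
      forall g : G, exists h k, [/\ h \in H, k \in K, src h = rng k & g = h ** k]
    & forall g : G, g \in H :&: K -> exists u, g = gunit u].

(* The default value is never used when [match_pair H K] holds. *)
Definition factor H K (g : G) : G * G :=
  odflt (g, g) [pick p : G * G |
    [&& p.1 \in H, p.2 \in K, src p.1 == rng p.2 & g == p.1 ** p.2]].
Definition p1 H K g := (factor H K g).1.
Definition p2 H K g := (factor H K g).2.
Definition mid H K g : gobj G := src (p1 H K g).

(* [kh = (lact k h) (ract k h)], for [src k = rng h]. *)
Definition lact H K (k h : G) := p1 H K (k ** h).
Definition ract H K (k h : G) := p2 H K (k ** h).

End MatchPair.

(* l^2 of a finite set; [l2 C X ⊗ l2 C Y] is identified with [l2 C (X * Y)],
   and L(l2 C X) is ['End(l2 C X)], with product the composition [\o]. *)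
Notation l2 C X := {ffun X -> C^o}.
Notation L2 C X := 'End(l2 C X).
Notation linform C X := 'Hom(L2 C X, C^o).

Section Operators.
Variable C : numClosedFieldType.
Implicit Types X Y Z : finType.

Definition ket X (x : X) : l2 C X := [ffun y => (y == x)%:R].

Definition kern X Y (T : 'Hom(l2 C Y, l2 C X)) (x : X) (y : Y) : C :=
  T (ket y) x.

Definition opk_fun X Y (k : X -> Y -> C) (f : l2 C Y) : l2 C X :=
  [ffun x => \sum_y k x y * f y].

Fact opk_fun_linear X Y (k : X -> Y -> C) : linear (opk_fun k).
Proof.
move=> a f g; apply/ffunP=> x; rewrite !ffunE scaler_sumr -big_split /=.
by apply: eq_bigr => y _; rewrite !ffunE mulrDr /GRing.scale /= mulrCA.
Qed.
HB.instance Definition _ X Y (k : X -> Y -> C) :=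
  GRing.isLinear.Build _ _ _ _ (opk_fun k) (opk_fun_linear k).

Definition opk X Y (k : X -> Y -> C) : 'Hom(l2 C Y, l2 C X) :=
  linfun (opk_fun k).

Lemma opkE X Y (k : X -> Y -> C) f x : opk k f x = \sum_y k x y * f y.
Proof. by rewrite lfunE /= ffunE. Qed.

Lemma kern_opk X Y (k : X -> Y -> C) x y : kern (opk k) x y = k x y.
Proof.
rewrite /kern opkE (bigD1 y) //= ffunE eqxx mulr1 big1 ?addr0 // => z zy.
by rewrite ffunE (negPf zy) mulr0.
Qed.

Lemma kernK X Y (T : 'Hom(l2 C Y, l2 C X)) : opk (kern T) = T.
Proof.
apply/lfunP => f; apply/ffunP => x; rewrite opkE.
have {2}-> : f = \sum_y f y *: ket y.
  apply/ffunP => z; rewrite sum_ffunE (bigD1 z) //= !ffunE eqxx.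
  rewrite big1 ?addr0 => [|y yz]; first by rewrite /GRing.scale /= mulr1.
  by rewrite !ffunE eq_sym (negPf yz) scaler0.
rewrite linear_sum sum_ffunE; apply: eq_bigr => y _.
by rewrite linearZ /= ffunE mulrC.
Qed.

Definition adj X Y (T : 'Hom(l2 C Y, l2 C X)) : 'Hom(l2 C X, l2 C Y) :=
  opk (fun y x => (kern T x y)^*).

Definition mxunit X (a b : X) : L2 C X :=
  opk (fun x y => ((x == a) && (y == b))%:R).

(* a ⊗ b *)
Definition tens X Y (a : L2 C X) (b : L2 C Y) : L2 C (X * Y) :=
  opk (fun p q => kern a p.1 q.1 * kern b p.2 q.2).

(* phi ⊗ psi, for linear maps phi and psi between operator spaces *)
Definition maptens X X' Y Y' (phi : L2 C X -> L2 C X') (psi : L2 C Y -> L2 C Y')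
    (W : L2 C (X * Y)) : L2 C (X' * Y') :=
  \sum_p \sum_q
    kern W p q *: tens (phi (mxunit p.1 q.1)) (psi (mxunit p.2 q.2)).

(* (w ⊗ i)(W) and (i ⊗ w)(W), for a linear form w *)
Definition slicel X Y (w : L2 C X -> C) (W : L2 C (X * Y)) : L2 C Y :=
  opk (fun y y' => w (opk (fun x x' => kern W (x, y) (x', y')))).
Definition slicer X Y (w : L2 C Y -> C) (W : L2 C (X * Y)) : L2 C X :=
  opk (fun x x' => w (opk (fun y y' => kern W (x, y) (x', y')))).

(* (w ⊗ w')(W) *)
Definition formtens X Y (w : L2 C X -> C) (w' : L2 C Y -> C)
    (W : L2 C (X * Y)) : C :=
  w' (slicel w W).

(* the linear map a ⊗ b |-> ab *)
Definition multop X (W : L2 C (X * X)) : L2 C X :=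
  \sum_p \sum_q kern W p q *: (mxunit p.1 q.1 \o mxunit p.2 q.2)%VF.

(* the linear map a ⊗ b |-> b ⊗ a *)
Definition flipop X Y (W : L2 C (X * Y)) : L2 C (Y * X) :=
  opk (fun p q => kern W (p.2, p.1) (q.2, q.1)).

(* the identification of (a ⊗ b) ⊗ c with a ⊗ (b ⊗ c) *)
Definition assocop X Y Z (W : L2 C (X * Y * Z)) : L2 C (X * (Y * Z)) :=
  opk (fun p q => kern W (p.1, p.2.1, p.2.2) (q.1, q.2.1, q.2.2)).

(* the flip Sigma of l^2(X x X) *)
Definition flip X : L2 C (X * X) :=
  opk (fun p q => (q == (p.2, p.1))%:R).

Definition slicel_form X Y (W : L2 C (X * Y)) (w : linform C X) := slicel w W.
Definition slicer_form X Y (W : L2 C (X * Y)) (w : linform C Y) := slicer w W.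

Lemma opk_linear X Y (a : C) (k k' : X -> Y -> C) :
  opk (fun x y => a * k x y + k' x y) = a *: opk k + opk k'.
Proof.
apply/lfunP => f; apply/ffunP => x.
rewrite add_lfunE scale_lfunE !ffunE !opkE scaler_sumr -big_split /=.
by apply: eq_bigr => y _; rewrite mulrDl /GRing.scale /= mulrA.
Qed.

Lemma eq_opk X Y (k k' : X -> Y -> C) : k =2 k' -> opk k = opk k'.
Proof.
move=> kk'; apply/lfunP => f; apply/ffunP => x; rewrite !opkE.
by apply: eq_bigr => y _; rewrite kk'.
Qed.

Fact slicel_form_linear X Y (W : L2 C (X * Y)) : linear (slicel_form W).
Proof.
move=> a v w; rewrite /slicel_form /slicel -opk_linear.
by apply: eq_opk => y y'; rewrite add_lfunE scale_lfunE.
Qed.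
HB.instance Definition _ X Y (W : L2 C (X * Y)) :=
  GRing.isLinear.Build _ _ _ _ (slicel_form W) (slicel_form_linear W).

Fact slicer_form_linear X Y (W : L2 C (X * Y)) : linear (slicer_form W).
Proof.
move=> a v w; rewrite /slicer_form /slicer -opk_linear.
by apply: eq_opk => x x'; rewrite add_lfunE scale_lfunE.
Qed.
HB.instance Definition _ X Y (W : L2 C (X * Y)) :=
  GRing.isLinear.Build _ _ _ _ (slicer_form W) (slicer_form_linear W).

End Operators.

Section WeakHopf.
Variable C : numClosedFieldType.
Implicit Types X Y : finType.

(* A finite-dimensional C*-algebra, concretely: a unital *-subalgebra of some
   L(l^2(X)) with X finite. *)
Definition cstar_subalgebra X (A : {vspace L2 C X}) : Prop :=
  [/\ \1%VF \in A,
      forall a b, a \in A -> b \in A -> (a \o b)%VF \in A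
    & forall a, a \in A -> adj a \in A].

(* [phi] matters only on A, where it is a *-isomorphism onto B. *)
Definition star_isomorphism X Y (A : {vspace L2 C X}) (B : {vspace L2 C Y})
    (phi : 'Hom(L2 C X, L2 C Y)) : Prop :=
  [/\ (phi @: A)%VS = B,
      {in A &, injective phi},
      {in A &, forall a b, phi (a \o b)%VF = (phi a \o phi b)%VF}
    & {in A, forall a, phi (adj a) = adj (phi a)}].

Definition vtens X Y (A : {vspace L2 C X}) (B : {vspace L2 C Y}) :
    {vspace L2 C (X * Y)} :=
  <<[seq tens a b | a <- vbasis A, b <- vbasis B]>>%VS.

(* Linear maps on an algebra A of operators are given by linear maps on the
   whole of L(l^2(X)), of which only the restriction to A is relevant. *)
Record whopf_data X := WHopfData {
  cop : 'Hom(L2 C X, L2 C (X * X));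
  antip : 'End(L2 C X);
  cou : linform C X
}.

Record weak_hopf X (A : {vspace L2 C X}) (D : whopf_data X) : Prop := WeakHopf {
  wh_alg : cstar_subalgebra A;
  wh_cop_in : {in A, forall x, cop D x \in vtens A A};
  wh_cop_mul : {in A &, forall x y, cop D (x \o y)%VF = (cop D x \o cop D y)%VF};
  wh_cop_adj : {in A, forall x, cop D (adj x) = adj (cop D x)};
  wh_coassoc : {in A, forall x,
    assocop (maptens (cop D) id (cop D x)) = maptens id (cop D) (cop D x)};
  wh_antip_in : {in A, forall x, antip D x \in A};
  wh_antip_mul : {in A &, forall x y,
    antip D (x \o y)%VF = (antip D y \o antip D x)%VF};
  wh_antip_adj : {in A, forall x, antip D (adj (antip D (adj x))) = x};
  wh_antip_cop : {in A, forall x,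
    maptens (antip D) (antip D) (cop D x) = flipop (cop D (antip D x))};
  wh_antip_cancel : {in A, forall x,
    maptens (fun W => multop (maptens (antip D) id W)) id
      (maptens (cop D) id (cop D x)) = (tens \1 x \o cop D \1)%VF};
  wh_cou_pos : {in A, forall x, 0 <= cou D (adj x \o x)%VF};
  wh_coul : {in A, forall x, slicel (cou D) (cop D x) = x};
  wh_cour : {in A, forall x, slicer (cou D) (cop D x) = x};
  wh_cou_mul : {in A &, forall x y,
    formtens (cou D) (cou D) (tens x \1 \o cop D \1 \o tens \1 y)%VF
    = cou D (x \o y)%VF}
}.

(* (A, D) and (A', D') are in duality for the bilinear form <x, y> = b x y. *)
Record whopf_duality X Y (A : {vspace L2 C X}) (D : whopf_data X)
    (A' : {vspace L2 C Y}) (D' : whopf_data Y)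
    (b : 'Hom(L2 C X, linform C Y)) : Prop := WHopfDuality {
  dual_ndl : {in A, forall x, {in A', forall y, b x y = 0} -> x = 0};
  dual_ndr : {in A', forall y, {in A, forall x, b x y = 0} -> y = 0};
  dual_mull : {in A &, forall x x', {in A', forall y,
    b (x \o x')%VF y = formtens (b x) (b x') (cop D' y)}};
  dual_mulr : {in A, forall x, {in A' &, forall y y',
    b x (y \o y')%VF = formtens (fun z => b z y) (fun z => b z y') (cop D x)}};
  dual_coul : {in A, forall x, b x \1%VF = cou D x};
  dual_cour : {in A', forall y, b \1%VF y = cou D' y};
  dual_antip : {in A, forall x, {in A', forall y,
    b (antip D x) y = b x (antip D' y)}};
  dual_adj : {in A, forall x, {in A', forall y,
    b (adj x) y = (b x (adj (antip D' y)))^*}}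
}.

(* D' is the image of the structure D on A under phi. *)
Definition whopf_transport X Y (A : {vspace L2 C X}) (D : whopf_data X)
    (D' : whopf_data Y) (phi : 'Hom(L2 C X, L2 C Y)) : Prop :=
  [/\ {in A, forall x, cop D' (phi x) = maptens phi phi (cop D x)},
      {in A, forall x, antip D' (phi x) = phi (antip D x)}
    & {in A, forall x, cou D' (phi x) = cou D x}].

End WeakHopf.

Section PartialIsometry.
Variables (C : numClosedFieldType) (G : groupoid) (H K : {set G}).

Local Notation p1 := (p1 H K).
Local Notation p2 := (p2 H K).
Local Notation mid := (mid H K).

Definition mpi_fun (f : l2 C (G * G)) : l2 C (G * G) :=
  [ffun p : G * G =>
     if mid p.1 == rng p.2 then
       f (p.1 ** p1 (ginv (p2 p.1) ** p.2), ginv (p2 p.1) ** p.2)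
     else 0].

Fact mpi_fun_linear : linear mpi_fun.
Proof.
move=> a f g; apply/ffunP=> p; rewrite !ffunE.
by case: ifP; rewrite ?scaler0 ?addr0 ?ffunE.
Qed.
HB.instance Definition _ := GRing.isLinear.Build _ _ _ _ mpi_fun mpi_fun_linear.

(* I_{H,K} *)
Definition mpi : L2 C (G * G) := linfun mpi_fun.

Definition alpha_fun (n : {ffun gobj G -> C}) (f : l2 C G) : l2 C G :=
  [ffun x : G => n (mid x) * f x].

Fact alpha_fun_linear n : linear (alpha_fun n).
Proof.
move=> a f g; apply/ffunP=> x; rewrite !ffunE.
by rewrite mulrDr /GRing.scale /= mulrCA.
Qed.
HB.instance Definition _ n :=
  GRing.isLinear.Build _ _ _ _ (alpha_fun n) (alpha_fun_linear n).

Definition alpha n : L2 C G := linfun (alpha_fun n).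

(* {(i ⊗ w)(Sigma I)} is the commutant of alpha(N), N = C(G^0) *)
Definition regular : Prop :=
  forall T : L2 C G,
    (exists w : linform C G, T = slicer w (flip C G \o mpi)%VF) <->
    (forall n, (T \o alpha n = alpha n \o T)%VF).

(* S = {(w ⊗ i)(I)} and its dual algebra {(i ⊗ w)(I)} *)
Definition algS : {vspace L2 C G} := limg (linfun (slicel_form mpi)).
Definition algShat : {vspace L2 C G} := limg (linfun (slicer_form mpi)).

(* D is the canonical structure of S (resp. of the dual algebra). *)
Definition S_structure (D : whopf_data C G) : Prop :=
  [/\ {in algS, forall x, cop D x = (mpi \o tens x \1 \o adj mpi)%VF},
      forall w : linform C G, antip D (slicel w mpi) = slicel w (adj mpi)
    & forall w : linform C G, cou D (slicel w mpi) = w \1%VF].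

Definition Shat_structure (D : whopf_data C G) : Prop :=
  [/\ {in algShat, forall x, cop D x = (adj mpi \o tens \1 x \o mpi)%VF},
      forall w : linform C G, antip D (slicer w mpi) = slicer w (adj mpi)
    & forall w : linform C G, cou D (slicer w mpi) = w \1%VF].

Definition S_pairing (b : 'Hom(L2 C G, linform C G)) : Prop :=
  forall w w' : linform C G,
    b (slicel w mpi) (slicer w' mpi) = formtens w w' mpi.

End PartialIsometry.

(* Extension by 0. In the formulas below it is only applied inside the domain
   {x | P x} when H and K form a match pair. *)
Definition ext0 (C : numClosedFieldType) (T : finType) (P : pred T)
    (F : l2 C {x : T | P x}) (x : T) : C :=
  if insub x is Some d then F d else 0.

Section CrossedProducts.
Variables (C : numClosedFieldType) (G : groupoid) (H K : {set G}).

Local Notation "k |> h" := (lact H K k h) (at level 39).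
Local Notation "k <| h" := (ract H K k h) (at level 39).

Definition KsrH : finType :=
  {p : G * G | [&& p.1 \in K, p.2 \in H & src p.1 == rng p.2]}.
Definition HrrK : finType :=
  {p : G * G | [&& p.1 \in H, p.2 \in K & rng p.1 == rng p.2]}.
Definition HrsK : finType :=
  {p : G * G | [&& p.1 \in H, p.2 \in K & rng p.1 == src p.2]}.

(* F ⋆ F' and F^# on K s×r H, and the operators R(F) of the right action *)
Definition dconv (F F' : l2 C KsrH) : l2 C KsrH :=
  [ffun d : KsrH => let: (k, h) := val d in
    \sum_(h' in H | rng h' == rng h)
      ext0 F (k, h') * ext0 F' (k <| h', ginv h' ** h)].
Definition dsharp (F : l2 C KsrH) : l2 C KsrH :=
  [ffun d : KsrH => let: (k, h) := val d in (ext0 F (k <| h, ginv h))^*].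

Definition Rdelta_fun (F xi : l2 C KsrH) : l2 C KsrH :=
  [ffun d : KsrH => let: (k, h) := val d in
    \sum_(h' in H | rng h' == src h) ext0 F (k <| h, h') * ext0 xi (k, h ** h')].

(* F ⋆ F' and F^# on H r×r K, and the operators L(F) of the left action *)
Definition gconv (F F' : l2 C HrrK) : l2 C HrrK :=
  [ffun d : HrrK => let: (h, k) := val d in
    \sum_(k' in K | rng k' == rng k)
      ext0 F (h, k') * ext0 F' (ginv k' |> h, ginv k' ** k)].
Definition gsharp (F : l2 C HrrK) : l2 C HrrK :=
  [ffun d : HrrK => let: (h, k) := val d in (ext0 F (ginv k |> h, ginv k))^*].

Definition Lgamma_fun (F : l2 C HrrK) (xi : l2 C HrsK) : l2 C HrsK :=
  [ffun d : HrsK => let: (h, k) := val d in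
    \sum_(k' in K | rng k' == rng k)
      ext0 F (k |> h, k') * ext0 xi (h, ginv k' ** k)].

Lemma ext0_linear (T : finType) (P : pred T) a (F F' : l2 C {x : T | P x}) x :
  ext0 (a *: F + F') x = a * ext0 F x + ext0 F' x.
Proof.
rewrite /ext0; case: insub => [d|]; last by rewrite mulr0 addr0.
by rewrite !ffunE.
Qed.

Fact Rdelta_fun_linear F : linear (Rdelta_fun F).
Proof.
move=> a f g; apply/ffunP=> d; rewrite !ffunE; case: (val d) => k h.
rewrite scaler_sumr -big_split; apply: eq_bigr => h' _ /=.
by rewrite ext0_linear mulrDr /GRing.scale /= mulrCA.
Qed.
HB.instance Definition _ F :=
  GRing.isLinear.Build _ _ _ _ (Rdelta_fun F) (Rdelta_fun_linear F).

Fact Lgamma_fun_linear F : linear (Lgamma_fun F).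
Proof.
move=> a f g; apply/ffunP=> d; rewrite !ffunE; case: (val d) => h k.
rewrite scaler_sumr -big_split; apply: eq_bigr => k' _ /=.
by rewrite ext0_linear mulrDr /GRing.scale /= mulrCA.
Qed.
HB.instance Definition _ F :=
  GRing.isLinear.Build _ _ _ _ (Lgamma_fun F) (Lgamma_fun_linear F).

Definition Rdelta (F : l2 C KsrH) : L2 C KsrH := linfun (Rdelta_fun F).
Definition Lgamma (F : l2 C HrrK) : L2 C HrsK := linfun (Lgamma_fun F).

Fact Rdelta_linear : linear Rdelta.
Proof.
move=> a F F'; apply/lfunP => xi; apply/ffunP => d.
rewrite add_lfunE scale_lfunE !lfunE /= !ffunE; case: (val d) => k h.
rewrite scaler_sumr -big_split; apply: eq_bigr => h' _ /=.
by rewrite ext0_linear mulrDl /GRing.scale /= mulrA.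
Qed.
HB.instance Definition _ := GRing.isLinear.Build _ _ _ _ Rdelta Rdelta_linear.

Fact Lgamma_linear : linear Lgamma.
Proof.
move=> a F F'; apply/lfunP => xi; apply/ffunP => d.
rewrite add_lfunE scale_lfunE !lfunE /= !ffunE; case: (val d) => h k.
rewrite scaler_sumr -big_split; apply: eq_bigr => k' _ /=.
by rewrite ext0_linear mulrDl /GRing.scale /= mulrA.
Qed.
HB.instance Definition _ := GRing.isLinear.Build _ _ _ _ Lgamma Lgamma_linear.

(* C(K) ⋊ C(H) and C(K) ⋉ C(H) *)
Definition crossR : {vspace L2 C KsrH} := limg (linfun Rdelta).
Definition crossL : {vspace L2 C HrsK} := limg (linfun Lgamma).

End CrossedProducts.

(* For a match pair, Rdelta and Lgamma are *-representations of the *-algebras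
   (dconv, dsharp) and (gconv, gsharp); their images are the crossed products. *)
Section MatchPairTheory.
Variables (G : groupoid) (H K : {set G}).
Hypothesis HK : match_pair H K.

Local Notation "k |> h" := (lact H K k h) (at level 39).
Local Notation "k <| h" := (ract H K k h) (at level 39).

Lemma gmulKV (x y : G) : src x = rng y -> ginv x ** (x ** y) = y.
Proof. by move=> xy; rewrite gmulA ?src_inv // gmulVl xy gmul1l. Qed.

Lemma gmulVK (x y : G) : rng x = rng y -> x ** (ginv x ** y) = y.
Proof. by move=> xy; rewrite gmulA ?rng_inv ?src_inv // gmulVr xy gmul1l. Qed.

Lemma ginv_eq (x y : G) : src x = rng y -> x ** y = gunit (rng x) -> y = ginv x.
Proof.
move=> xy e; rewrite -[y in LHS](gmulKV xy) e -(src_inv x) gmul1r //.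
Qed.

Lemma ginvK (x : G) : ginv (ginv x) = x.
Proof. by apply/esym/ginv_eq; rewrite ?src_inv // gmulVl rng_inv. Qed.

Lemma ginvM (x y : G) : src x = rng y -> ginv (x ** y) = ginv y ** ginv x.
Proof.
move=> xy; apply/esym/ginv_eq.
  by rewrite src_mul // rng_mul rng_inv // src_inv.
rewrite -gmulA ?rng_mul ?rng_inv ?src_inv //.
by rewrite gmulVK ?rng_inv // gmulVr.
Qed.

Lemma factorP g :
  [/\ p1 H K g \in H, p2 H K g \in K, src (p1 H K g) = rng (p2 H K g)
    & g = p1 H K g ** p2 H K g].
Proof.
rewrite /p1 /p2 /factor; case: pickP => [p /and4P[? ? /eqP ? /eqP ?] //|/= none].
have [_ _ /(_ g)[h [k [hH kK hk gE]]] _] := HK.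
by have := none (h, k); rewrite /= hH kK hk gE !eqxx.
Qed.

Lemma factor_unique h k : h \in H -> k \in K -> src h = rng k ->
  p1 H K (h ** k) = h /\ p2 H K (h ** k) = k.
Proof.
move=> hH kK hk; have [h'H k'K hk' e] := factorP (h ** k).
set h' := p1 H K _ in h'H hk' e *; set k' := p2 H K _ in k'K hk' e *.
have [[HM HV] [KM KV] _ HKu] := HK.
have rh : rng h' = rng h by rewrite -(rng_mul hk) e rng_mul.
have sk : src k' = src k by rewrite -(src_mul hk) e src_mul.
have c : src (ginv h ** h') = rng k' by rewrite src_mul ?src_inv.
have kE : k = (ginv h ** h') ** k' by rewrite -gmulA ?src_inv ?rh // -e gmulKV.
have e2 : ginv h ** h' = k ** ginv k'.
  by rewrite kE -gmulA ?rng_inv // gmulVr -c gmul1r.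
have [|u uE] := HKu (ginv h ** h').
  rewrite inE HM ?src_inv ?HV //= e2 KM ?KV // rng_inv //.
have hh : h' = h.
  have us : u = src h.
    by rewrite -(rng_unit u) -uE rng_mul ?src_inv ?rng_inv.
  by rewrite -[h'](@gmulVK h) // uE us gmul1r.
split=> //; move: e; rewrite hh => /(congr1 (gmul (ginv h))).
by rewrite !gmulKV // -hh.
Qed.


Lemma act_spec k h : k \in K -> h \in H -> src k = rng h ->
  [/\ k |> h \in H, k <| h \in K & src (k |> h) = rng (k <| h)] /\
  [/\ k ** h = (k |> h) ** (k <| h), rng (k |> h) = rng k
    & src (k <| h) = src h].
Proof.
move=> kK hH kh; have [pH pK pq e] := factorP (k ** h).
split; split=> //; rewrite /lact /ract.
  by rewrite -(rng_mul pq) -e rng_mul.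
by rewrite -(src_mul pq) -e src_mul.
Qed.

Lemma ractM k h h' : k \in K -> h \in H -> h' \in H ->
  src k = rng h -> src h = rng h' -> k <| (h ** h') = (k <| h) <| h'.
Proof.
move=> kK hH h'H kh hh'; have [[aH aK ac] [e er es]] := act_spec kK hH kh.
have [[bH bK bc] [e' er' es']] := act_spec aK h'H (etrans es hh').
rewrite {1}/ract gmulA // e -gmulA ?es // e' gmulA ?er' //.
have [[HM _] _ _ _] := HK.
by apply: (factor_unique _ bK _).2; rewrite ?HM ?src_mul ?er'.
Qed.

Lemma lactM k k' h : k \in K -> k' \in K -> h \in H ->
  src k' = rng k -> src k = rng h -> (k' ** k) |> h = k' |> (k |> h).
Proof.
move=> kK k'K hH kk' kh; have [[aH aK ac] [e er es]] := act_spec kK hH kh.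
have [[bH bK bc] [e' er' es']] := act_spec k'K aH (etrans kk' (esym er)).
rewrite {1}/lact -gmulA // e gmulA ?er // e' -gmulA ?es' //.
have [_ [KM _] _ _] := HK.
by apply: (factor_unique bH _ _).1; rewrite ?KM ?rng_mul ?es'.
Qed.

Variable C : numClosedFieldType.

Lemma ext0E (T : finType) (P : pred T) (F : l2 C {x : T | P x}) d :
  ext0 F (val d) = F d.
Proof. by rewrite /ext0 valK. Qed.

Lemma ext0_ffun (T : finType) (P : pred T) (F : T -> C) x : P x ->
  ext0 ([ffun d : {x : T | P x} => F (val d)] : l2 C _) x = F x.
Proof. by move=> Px; rewrite /ext0 insubT ffunE. Qed.

Lemma ext0_ket (T : finType) (P : pred T) (e : {x : T | P x}) x :
  ext0 (ket C e) x = (x == val e)%:R.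
Proof.
rewrite /ext0; case: insubP => [d Px <-|/negP nPx]; first by rewrite ffunE.
by case: eqP => // xe; case: nPx; rewrite xe (valP e).
Qed.

Lemma big_sig (T : finType) (P : pred T) (F : T -> C) :
  \sum_(d : {x : T | P x}) F (val d) = \sum_(x | P x) F x.
Proof.
rewrite (reindex_omap (val : {x : T | P x} -> T) insub) /=.
  by apply: eq_bigl => d; rewrite (valP d) valK eqxx.
by move=> x Px; rewrite insubT.
Qed.

Lemma kern_comp (X Y Z : finType) (T : 'Hom(l2 C Y, l2 C X))
    (U : 'Hom(l2 C Z, l2 C Y)) x z :
  kern (T \o U)%VF x z = \sum_y kern T x y * kern U y z.
Proof. by rewrite /kern comp_lfunE -[in LHS](kernK T) opkE. Qed.

Lemma eq_kern (X Y : finType) (T U : 'Hom(l2 C Y, l2 C X)) :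
  kern T =2 kern U -> T = U.
Proof. by move=> e; rewrite -(kernK T) (eq_opk e) kernK. Qed.

Lemma Rdelta_kern (F : l2 C (KsrH H K)) d e :
  kern (Rdelta F) d e =
  if (val e).1 == (val d).1 then
    ext0 F ((val d).1 <| (val d).2, ginv (val d).2 ** (val e).2)
  else 0.
Proof.
rewrite /kern lfunE /= ffunE.
move: (ext0_ket e) (valP d) (valP e); rewrite /=.
case: (val d) => k h; case: (val e) => k' h' /=.
move=> ketE; under eq_bigr do rewrite ketE.
case/and3P=> kK hH /eqP kh /and3P[k'K h'H /eqP kh'].
have [[HM HV] _ _ _] := HK.
case: eqP => [?|ne]; last first.
  rewrite big1 // => h1 _; rewrite (_ : _ == _ = false) ?mulr0 //.
  by apply/eqP => -[/esym].
subst k'; have rh : rng h = rng h' by rewrite -kh.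
rewrite (bigD1 (ginv h ** h')) /=; last first.
  by rewrite HM ?HV ?src_inv // rng_mul ?src_inv ?rng_inv ?eqxx.
rewrite gmulVK // eqxx mulr1 big1 ?addr0 // => h1 /andP[/andP[_ /eqP h1r] ne].
rewrite (_ : _ == _ = false) ?mulr0 //; apply/eqP => -[e1].
by rewrite -e1 gmulKV ?eqxx in ne.
Qed.

Lemma Rdelta_mul (F F' : l2 C (KsrH H K)) :
  Rdelta (dconv F F') = (Rdelta F \o Rdelta F')%VF.
Proof.
apply: eq_kern => d e; rewrite kern_comp Rdelta_kern.
under eq_bigr do rewrite !Rdelta_kern.
move: (valP d) (valP e); rewrite /=.
case: (val d) => k h; case: (val e) => k' h' /=.
case/and3P=> kK hH /eqP kh /and3P[k'K h'H /eqP kh'].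
have [[HM HV] _ _ _] := HK.
rewrite (big_sig _ (fun p => (if p.1 == k then ext0 F (k <| h, ginv h ** p.2)
  else 0) * (if k' == p.1 then ext0 F' (p.1 <| p.2, ginv p.2 ** h') else 0))).
case: eqP => [?|ne]; last first.
  rewrite big1 // => p _; case: eqP => [->|]; rewrite ?mul0r //.
  by case: eqP; rewrite ?mulr0.
subst k'; have rh : rng h = rng h' by rewrite -kh.
have [[aH aK ac] [ae er es]] := act_spec kK hH kh.
rewrite (bigID (fun p => p.1 == k)) /= [X in _ + X]big1 ?addr0; last first.
  by move=> p /andP[_ /negPf->]; rewrite mul0r.
rewrite (reindex_onto (fun h1 => (k, h ** h1)) (fun p => ginv h ** p.2)) /=; last first.
  move=> [p1 p2] /= /andP[/and3P[_ p2H /eqP e1] /eqP e2]; subst p1.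
  by rewrite gmulVK // -kh e1.
rewrite (ext0_ffun (fun p : G * G => let: (k, h) := p in
    \sum_(h' in H | rng h' == rng h)
      ext0 F (k, h') * ext0 F' (k <| h', ginv h' ** h))) /=; last first.
  by rewrite aK HM ?HV ?src_inv // es rng_mul ?src_inv // rng_inv eqxx.
rewrite rng_mul ?src_inv // rng_inv.
have E h1 : (h1 \in H) && (rng h1 == src h) =
  [&& k \in K, h ** h1 \in H & src k == rng (h ** h1)] && (k == k)
  && (ginv h ** (h ** h1) == h1).
  apply/andP/idP => [[h1H /eqP h1r]|].
    by rewrite kK HM //= rng_mul // kh gmulKV // !eqxx.
  case/andP=> /andP[/and3P[_ hh /eqP c] _] /eqP <-.
  rewrite HM ?HV ?src_inv -?c // rng_mul ?src_inv -?c // rng_inv //.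
rewrite (eq_bigl _ _ E); apply: eq_bigr => h1; rewrite -E => /andP[h1H /eqP h1r].
rewrite !eqxx gmulKV // -ractM //; congr (_ * ext0 _ (_, _)).
by rewrite ginvM // gmulA ?src_inv ?rng_inv.
Qed.

Lemma Rdelta_adj (F : l2 C (KsrH H K)) : Rdelta (dsharp F) = adj (Rdelta F).
Proof.
apply: eq_kern => d e; rewrite kern_opk !Rdelta_kern.
move: (valP d) (valP e); rewrite /=.
case: (val d) => k h; case: (val e) => k' h' /=.
case/and3P=> kK hH /eqP kh /and3P[k'K h'H /eqP kh'].
have [[HM HV] _ _ _] := HK.
rewrite eq_sym; case: eqP => [?|_]; last by rewrite rmorph0.
subst k'; have rh : rng h = rng h' by rewrite -kh.
have [[aH aK ac] [ae er es]] := act_spec kK hH kh.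
rewrite (ext0_ffun (fun p : G * G => let: (k, h) := p in
    (ext0 F (k <| h, ginv h))^*)) /=; last first.
  by rewrite aK HM ?HV ?src_inv // es rng_mul ?src_inv // rng_inv eqxx.
rewrite -ractM ?HM ?HV ?src_inv ?rng_mul ?src_inv ?rng_inv // gmulVK //.
by rewrite ginvM ?src_inv // ginvK.
Qed.

Lemma Lgamma_kern (F : l2 C (HrrK H K)) d e :
  kern (Lgamma F) d e =
  if (val e).1 == (val d).1 then
    ext0 F ((val d).2 |> (val d).1, (val d).2 ** ginv (val e).2)
  else 0.
Proof.
rewrite /kern lfunE /= ffunE.
move: (ext0_ket e) (valP d) (valP e); rewrite /=.
case: (val d) => h k; case: (val e) => h' k' /=.
move=> ketE; under eq_bigr do rewrite ketE.
case/and3P=> hH kK /eqP hk /and3P[h'H k'K /eqP hk'].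
have [_ [KM KV] _ _] := HK.
case: eqP => [?|ne]; last first.
  rewrite big1 // => k1 _; rewrite (_ : _ == _ = false) ?mulr0 //.
  by apply/eqP => -[/esym].
subst h'; have sk : src k = rng (ginv k') by rewrite rng_inv -hk.
rewrite (bigD1 (k ** ginv k')) /=; last first.
  by rewrite KM ?KV // rng_mul ?eqxx.
rewrite [ginv _ ** k](_ : _ = k'); last first.
  by rewrite ginvM // ginvK -gmulA ?src_inv ?rng_inv // -?hk' // gmulVl -hk hk' gmul1r.
rewrite eqxx mulr1 big1 ?addr0 // => k1 /andP[/andP[_ /eqP k1r] ne].
rewrite (_ : _ == _ = false) ?mulr0 //; apply/eqP => -[e1].
case/eqP: ne; rewrite -e1 ginvM ?src_inv // ginvK gmulA ?rng_inv ?src_inv //.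
by rewrite gmulVr -k1r gmul1l.
Qed.

Lemma Lgamma_mul (F F' : l2 C (HrrK H K)) :
  Lgamma (gconv F F') = (Lgamma F \o Lgamma F')%VF.
Proof.
apply: eq_kern => d e; rewrite kern_comp Lgamma_kern.
under eq_bigr do rewrite !Lgamma_kern.
move: (valP d) (valP e); rewrite /=.
case: (val d) => h k; case: (val e) => h' k' /=.
case/and3P=> hH kK /eqP hk /and3P[h'H k'K /eqP hk'].
have [_ [KM KV] _ _] := HK.
rewrite (big_sig _ (fun p => (if p.1 == h then ext0 F (k |> h, k ** ginv p.2)
  else 0) * (if h' == p.1 then ext0 F' (p.2 |> p.1, p.2 ** ginv k') else 0))).
case: eqP => [?|ne]; last first.
  rewrite big1 // => p _; case: eqP => [->|]; rewrite ?mul0r //.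
  by case: eqP; rewrite ?mulr0.
subst h'; have sk : src k = src k' by rewrite -hk.
have [[aH aK ac] [ae er es]] := act_spec kK hH (esym hk).
rewrite (bigID (fun p => p.1 == h)) /= [X in _ + X]big1 ?addr0; last first.
  by move=> p /andP[_ /negPf->]; rewrite mul0r.
rewrite (reindex_onto (fun k1 => (h, ginv k1 ** k)) (fun p => k ** ginv p.2)) /=; last first.
  move=> [q1 q2] /= /andP[/and3P[_ q2K /eqP e1] /eqP e2]; subst q1.
  have c : src k = src q2 by rewrite -hk.
  by rewrite ginvM ?rng_inv // ginvK -gmulA ?src_inv ?rng_inv // gmulVl c gmul1r.
rewrite (ext0_ffun (fun p : G * G => let: (h, k) := p in
    \sum_(k' in K | rng k' == rng k)
      ext0 F (h, k') * ext0 F' (ginv k' |> h, ginv k' ** k))) /=; last first.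
  by rewrite aH KM ?KV ?rng_inv // er rng_mul ?rng_inv // eqxx.
rewrite rng_mul ?rng_inv //.
have kKV k1 : rng k1 = rng k -> k ** ginv (ginv k1 ** k) = k1.
  move=> r1; rewrite ginvM ?src_inv // ginvK gmulA ?rng_inv ?src_inv //.
  by rewrite gmulVr -r1 gmul1l.
have E k1 : (k1 \in K) && (rng k1 == rng k) =
  [&& h \in H, ginv k1 ** k \in K & rng h == src (ginv k1 ** k)] && (h == h)
  && (k ** ginv (ginv k1 ** k) == k1).
  apply/andP/idP => [[k1K /eqP k1r]|].
    by rewrite hH KM ?KV ?src_inv //= src_mul ?src_inv // hk kKV // !eqxx.
  case/andP=> /andP[/and3P[_ kk /eqP c] _] /eqP <-.
  by rewrite KM ?KV ?rng_inv -?c // rng_mul ?rng_inv -?c.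
rewrite (eq_bigl _ _ E); apply: eq_bigr => k1; rewrite -E => /andP[k1K /eqP k1r].
rewrite !eqxx kKV // -lactM ?KV ?src_inv //; congr (_ * ext0 _ (_, _)).
by rewrite gmulA ?src_inv ?rng_inv.
Qed.

Lemma Lgamma_adj (F : l2 C (HrrK H K)) : Lgamma (gsharp F) = adj (Lgamma F).
Proof.
apply: eq_kern => d e; rewrite kern_opk !Lgamma_kern.
move: (valP d) (valP e); rewrite /=.
case: (val d) => h k; case: (val e) => h' k' /=.
case/and3P=> hH kK /eqP hk /and3P[h'H k'K /eqP hk'].
have [_ [KM KV] _ _] := HK.
rewrite eq_sym; case: eqP => [?|_]; last by rewrite rmorph0.
subst h'; have sk : src k = src k' by rewrite -hk.
have [[aH aK ac] [ae er es]] := act_spec kK hH (esym hk).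
rewrite (ext0_ffun (fun p : G * G => let: (h, k) := p in
    (ext0 F (ginv k |> h, ginv k))^*)) /=; last first.
  by rewrite aH KM ?KV ?rng_inv // er rng_mul ?rng_inv // eqxx.
rewrite ginvM ?rng_inv // ginvK -lactM ?KM ?KV ?src_mul ?src_inv ?rng_inv //.
by rewrite -gmulA ?src_inv ?rng_inv // gmulVl sk gmul1r.
Qed.

End MatchPairTheory.

(* Main.v *)
Require Import Defs.
From HB Require Import structures.
From mathcomp Require Import all_boot all_order all_algebra.
From mathcomp Require Import reals complex.

Set Implicit Arguments.
Unset Strict Implicit.
Unset Printing Implicit Defensive.

Import Order.TTheory GRing.Theory Num.Theory.
Local Open Scope ring_scope.

(** Every [g] in [G] has two factorizations, [g = l ** b] with [l] in [K] and
    [b] in [H], and [g = t ** r] with [t] in [H] and [r] in [K].  So [g] is a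
    square with left, bottom, top and right edges [l], [b], [t], [r], written
    [lft g], [bot g], [top g], [rgt g] below, and two adjacent edges determine
    it.  Squares can be stacked vertically
    ([lft e ** f], when [bot e = top f]) and horizontally ([top e ** f], when
    [rgt e = lft f]); each composition is a groupoid structure on the set of
    squares, they satisfy the interchange law, and exchanging [H] and [K]
    exchanges them.  The vertical inverse of [g] is [ginv (lft g) ** top g],
    its horizontal inverse is [ginv (top g) ** lft g], the composite of the two
    is [ginv g], and [ginv (top a) ** g] is what remains of [g] once a square
    [a] with the same left edge is removed on the left.

    The partial isometry splits over the squares ([mpi_sum]):
      [I = \sum_g V g ⊗ T g],
    where [T g], or [lop g], is a partial left translation by [lft g], and [V g],
    or [rop g], a partial right translation by [bot g].  The families [T] and [V] are free, so [S] is
    the span of the [T g] and its dual the span of the [V g], with [T] and [V]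
    dual bases for the pairing.  The [T g] multiply as vertical composition
    ([lop_box]), the [V g] as horizontal composition ([rop_box]), hence the
    coproduct of [T g] is the sum of the [T a ⊗ T f] over the horizontal
    factorizations of [g] into [a] and [f] ([lop_cop]), the antipode sends
    [T g] to [T (ginv g)], and the counit is the indicator of the horizontal
    identities, which are the elements of [K].

    All axioms then become statements on squares.  They are proved once, for
    any family of operators multiplying as vertical composition
    ([box_weak_hopf]): multiplicativity of the coproduct is the interchange law
    ([box_interchange]), and the antipode axiom holds because a square composed
    with its inverse leaves only an identity.  The result is used four times:
    for [T], for [V] (with [H] and [K] exchanged), and for the crossed
    products.  For these, the bijections [(h, k) |-> k ** h] and
    [(k, h) |-> k ** h] onto [G] carry the operators [Lgamma (ket _)] and
    [Rdelta (ket _)] to the [T g] and the [V g] ([Lgamma_ket], [Rdelta_ket]), so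
    that the isomorphisms only change the basis.

    Regularity holds because [Sigma I] has exactly one nonzero entry for each
    composable pair [(y, y')], which contributes to the slices the matrix unit
    with row [rgt y ** y'] and column [y ** top y'], and these are the pairs of
    elements with equal [mid] ([mid_flip], [flip_splitP]); the commutant of
    [alpha(N)] consists of the operators whose entries vanish off such pairs. *)

(** * Operators on finite l2 spaces *)

Section OperatorCalculus.
Variable C : numClosedFieldType.
Implicit Types X Y Z : finType.

Lemma kernP X Y a (T U : 'Hom(l2 C Y, l2 C X)) x y :
  kern (a *: T + U) x y = a * kern T x y + kern U x y.
Proof. by rewrite /kern add_lfunE scale_lfunE !ffunE. Qed.

Lemma kern_sum X Y I (s : seq I) (P : pred I) (T : I -> 'Hom(l2 C Y, l2 C X)) x y :
  kern (\sum_(i <- s | P i) T i) x y = \sum_(i <- s | P i) kern (T i) x y.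
Proof. by rewrite /kern sum_lfunE sum_ffunE. Qed.

Lemma kernZ X Y a (T : 'Hom(l2 C Y, l2 C X)) x y :
  kern (a *: T) x y = a * kern T x y.
Proof. by rewrite /kern scale_lfunE ffunE. Qed.

Lemma kern1 X (x y : X) : kern (\1%VF : L2 C X) x y = (x == y)%:R.
Proof. by rewrite /kern id_lfunE ffunE. Qed.

Lemma kern_adj X Y (T : 'Hom(l2 C Y, l2 C X)) x y :
  kern (adj T) y x = (kern T x y)^*.
Proof. by rewrite kern_opk. Qed.

Lemma kern_mxunit X (a b x y : X) :
  kern (mxunit C a b) x y = ((x == a) && (y == b))%:R.
Proof. by rewrite kern_opk. Qed.

Lemma kern_tens X Y (a : L2 C X) (b : L2 C Y) p q :
  kern (tens a b) p q = kern a p.1 q.1 * kern b p.2 q.2.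
Proof. by rewrite kern_opk. Qed.

Lemma adjP X Y a (T U : 'Hom(l2 C Y, l2 C X)) :
  adj (a *: T + U) = a^* *: adj T + adj U.
Proof.
by apply: eq_kern => y x; rewrite kernP !kern_adj kernP rmorphD rmorphM.
Qed.

Lemma adj_scale X Y a (T : 'Hom(l2 C Y, l2 C X)) : adj (a *: T) = a^* *: adj T.
Proof.
by apply: eq_kern => y x; rewrite kernZ !kern_adj kernZ rmorphM.
Qed.

Lemma adj_adj X Y (T : 'Hom(l2 C Y, l2 C X)) : adj (adj T) = T.
Proof. by apply: eq_kern => x y; rewrite !kern_adj conjCK. Qed.

Lemma adj_sum X Y I (s : seq I) (P : pred I) (T : I -> 'Hom(l2 C Y, l2 C X)) :
  adj (\sum_(i <- s | P i) T i) = \sum_(i <- s | P i) adj (T i).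
Proof.
apply: eq_kern => y x; rewrite kern_sum kern_adj kern_sum rmorph_sum.
by apply: eq_bigr => i _; rewrite kern_adj.
Qed.

Lemma adj_tens X Y (a : L2 C X) (b : L2 C Y) :
  adj (tens a b) = tens (adj a) (adj b).
Proof.
by apply: eq_kern => p q; rewrite kern_adj !kern_tens !kern_adj rmorphM.
Qed.

Lemma op_mxunit X (a : L2 C X) : a = \sum_x \sum_y kern a x y *: mxunit C x y.
Proof.
apply: eq_kern => x y; rewrite kern_sum (bigD1 x) //= kern_sum (bigD1 y) //=.
rewrite kernZ kern_mxunit !eqxx mulr1 big1 => [|z zy].
  rewrite addr0 big1 ?addr0 // => z zx; rewrite kern_sum big1 // => t _.
  by rewrite kernZ kern_mxunit eq_sym (negPf zx) mulr0.
by rewrite kernZ kern_mxunit andbC eq_sym (negPf zy) mulr0.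
Qed.

Fact tensl_linear X Y (b : L2 C Y) : linear (fun a : L2 C X => tens a b).
Proof.
by move=> c a a'; apply: eq_kern => p q;
  rewrite !(kernP, kern_tens) mulrDl mulrA.
Qed.
Fact tensr_linear X Y (a : L2 C X) : linear (fun b : L2 C Y => tens a b).
Proof.
by move=> c b b'; apply: eq_kern => p q;
  rewrite !(kernP, kern_tens) mulrDr mulrCA.
Qed.
HB.instance Definition _ X Y (a : L2 C X) :=
  GRing.isLinear.Build _ _ _ _ (@tens C X Y a) (tensr_linear a).

Lemma tens_sumr X Y I (s : seq I) (P : pred I) (a : L2 C X) (b : I -> L2 C Y) :
  tens a (\sum_(i <- s | P i) b i) = \sum_(i <- s | P i) tens a (b i).
Proof. exact: linear_sum. Qed.

Lemma tensZr X Y c (a : L2 C X) (b : L2 C Y) : tens a (c *: b) = c *: tens a b.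
Proof. exact: linearZ. Qed.

Lemma tens_suml X Y I (s : seq I) (P : pred I) (a : I -> L2 C X) (b : L2 C Y) :
  tens (\sum_(i <- s | P i) a i) b = \sum_(i <- s | P i) tens (a i) b.
Proof.
by apply: eq_kern => p q; rewrite kern_sum kern_tens kern_sum mulr_suml;
  apply: eq_bigr => i _; rewrite kern_tens.
Qed.

Lemma tensZl X Y c (a : L2 C X) (b : L2 C Y) : tens (c *: a) b = c *: tens a b.
Proof. by apply: eq_kern => p q; rewrite !(kernZ, kern_tens) mulrA. Qed.

Lemma tens0l X Y (b : L2 C Y) : tens (0 : L2 C X) b = 0.
Proof. by rewrite -[0](scale0r 0) tensZl scale0r. Qed.

Lemma tens0r X Y (a : L2 C X) : tens a (0 : L2 C Y) = 0.
Proof. by rewrite -[0](scale0r 0) tensZr scale0r. Qed.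

Lemma tens_comp X Y (a c : L2 C X) (b d : L2 C Y) :
  (tens a b \o tens c d)%VF = tens (a \o c)%VF (b \o d)%VF.
Proof.
apply: eq_kern => p q; rewrite kern_comp kern_tens !kern_comp big_distrlr /=.
rewrite pair_bigA; apply: eq_bigr => z _.
by rewrite !kern_tens mulrACA.
Qed.

Lemma comp_suml X I (s : seq I) (P : pred I) (a : I -> L2 C X) (b : L2 C X) :
  ((\sum_(i <- s | P i) a i) \o b)%VF = \sum_(i <- s | P i) (a i \o b)%VF.
Proof.
elim/big_rec2: _ => [|i x y _ <-]; first by rewrite comp_lfun0l.
by rewrite comp_lfunDl.
Qed.

Lemma comp_sumr X I (s : seq I) (P : pred I) (a : L2 C X) (b : I -> L2 C X) :
  (a \o (\sum_(i <- s | P i) b i))%VF = \sum_(i <- s | P i) (a \o b i)%VF.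
Proof.
elim/big_rec2: _ => [|i x y _ <-]; first by rewrite comp_lfun0r.
by rewrite comp_lfunDr.
Qed.

Section MapTens.
Variables (X X' Y Y' : finType).
Variables (phi : L2 C X -> L2 C X') (psi : L2 C Y -> L2 C Y').

Fact maptens_linear : linear (maptens phi psi).
Proof.
move=> c W W'; rewrite /maptens scaler_sumr -big_split; apply: eq_bigr => p _.
rewrite scaler_sumr -big_split; apply: eq_bigr => q _ /=.
by rewrite kernP scalerDl scalerA.
Qed.
HB.instance Definition _ :=
  GRing.isLinear.Build _ _ _ _ (maptens phi psi) maptens_linear.

Lemma maptens_sum I (s : seq I) (P : pred I) (W : I -> L2 C (X * Y)) :
  maptens phi psi (\sum_(i <- s | P i) W i) =
  \sum_(i <- s | P i) maptens phi psi (W i).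
Proof. exact: linear_sum. Qed.

(** The definition of [maptens] by matrix units makes sense for arbitrary maps,
    so linearity enters as a hypothesis; this covers maps without a declared
    linear structure, such as [fun W => multop (maptens _ id W)]. *)
Lemma maptens_tens a b : linear phi -> linear psi ->
  maptens phi psi (tens a b) = tens (phi a) (psi b).
Proof.
move=> phiL psiL.
pose phi' : {linear _ -> _} :=
  HB.pack phi (GRing.isLinear.Build _ _ _ _ phi phiL).
pose psi' : {linear _ -> _} :=
  HB.pack psi (GRing.isLinear.Build _ _ _ _ psi psiL).
have phiE : phi a = \sum_p kern a p.1 p.2 *: phi (mxunit C p.1 p.2).
  rewrite -(pair_bigA _ (fun x y => kern a x y *: phi (mxunit C x y))) /=.
  rewrite {1}[a]op_mxunit -[phi]/(phi' : _ -> _) linear_sum.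
  by apply: eq_bigr => x _; rewrite linear_sum; apply: eq_bigr => y _;
     rewrite linearZ.
have psiE : psi b = \sum_p kern b p.1 p.2 *: psi (mxunit C p.1 p.2).
  rewrite -(pair_bigA _ (fun x y => kern b x y *: psi (mxunit C x y))) /=.
  rewrite {1}[b]op_mxunit -[psi]/(psi' : _ -> _) linear_sum.
  by apply: eq_bigr => x _; rewrite linear_sum; apply: eq_bigr => y _;
     rewrite linearZ.
rewrite phiE psiE tens_suml; under [RHS]eq_bigr do rewrite tens_sumr.
rewrite /maptens !pair_bigA /=.
rewrite (reindex (fun r : X * X * (Y * Y) => ((r.1.1, r.2.1), (r.1.2, r.2.2)))) /=.
  by apply: eq_bigr => r _; rewrite kern_tens tensZl tensZr scalerA.
exists (fun r : X * Y * (X * Y) => ((r.1.1, r.2.1), (r.1.2, r.2.2))).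
  by move=> [[? ?] [? ?]].
by move=> [[? ?] [? ?]].
Qed.

End MapTens.

Fact multop_linear X : linear (@multop C X).
Proof.
move=> c W W'; rewrite /multop scaler_sumr -big_split; apply: eq_bigr => p _.
rewrite scaler_sumr -big_split; apply: eq_bigr => q _ /=.
by rewrite kernP scalerDl scalerA.
Qed.
HB.instance Definition _ X :=
  GRing.isLinear.Build _ _ _ _ (@multop C X) (@multop_linear X).

Lemma multop_tens X (a b : L2 C X) : multop (tens a b) = (a \o b)%VF.
Proof.
rewrite {2}[a]op_mxunit {2}[b]op_mxunit !pair_bigA /= comp_suml.
under [RHS]eq_bigr do rewrite comp_sumr.
rewrite /multop !pair_bigA /=.
rewrite (reindex (fun r : X * X * (X * X) => ((r.1.1, r.2.1), (r.1.2, r.2.2)))) /=.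
  apply: eq_bigr => r _.
  by rewrite kern_tens -comp_lfunZl -comp_lfunZr scalerA.
exists (fun r : X * X * (X * X) => ((r.1.1, r.2.1), (r.1.2, r.2.2))).
  by move=> [[? ?] [? ?]].
by move=> [[? ?] [? ?]].
Qed.

Fact flipop_linear X Y : linear (@flipop C X Y).
Proof. by move=> c W W'; apply: eq_kern => p q; rewrite !(kernP, kern_opk). Qed.
HB.instance Definition _ X Y :=
  GRing.isLinear.Build _ _ _ _ (@flipop C X Y) (@flipop_linear X Y).

Lemma flipop_sum X Y I (s : seq I) (P : pred I) (W : I -> L2 C (X * Y)) :
  flipop (\sum_(i <- s | P i) W i) = \sum_(i <- s | P i) flipop (W i).
Proof. exact: linear_sum. Qed.

Lemma flipop_tens X Y (a : L2 C X) (b : L2 C Y) : flipop (tens a b) = tens b a.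
Proof. by apply: eq_kern => p q; rewrite !(kern_tens, kern_opk) /= mulrC. Qed.

Fact assocop_linear X Y Z : linear (@assocop C X Y Z).
Proof. by move=> c W W'; apply: eq_kern => p q; rewrite !(kernP, kern_opk). Qed.
HB.instance Definition _ X Y Z :=
  GRing.isLinear.Build _ _ _ _ (@assocop C X Y Z) (@assocop_linear X Y Z).

Lemma assocop_sum X Y Z I (s : seq I) (P : pred I) (W : I -> L2 C (X * Y * Z)) :
  assocop (\sum_(i <- s | P i) W i) = \sum_(i <- s | P i) assocop (W i).
Proof. exact: linear_sum. Qed.

Lemma assocop_tens X Y Z (a : L2 C X) (b : L2 C Y) (c : L2 C Z) :
  assocop (tens (tens a b) c) = tens a (tens b c).
Proof. by apply: eq_kern => p q; rewrite !(kern_tens, kern_opk) /= mulrA. Qed.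

Section Slices.
Variables (X Y I : finType) (P : pred I).
Variables (a : I -> L2 C X) (b : I -> L2 C Y).

Lemma slicel_sum_tens (w : L2 C X -> C^o) : linear w ->
  slicel w (\sum_(i | P i) tens (a i) (b i)) = \sum_(i | P i) w (a i) *: b i.
Proof.
move=> wL; pose w' : {linear _ -> _} := HB.pack w (GRing.isLinear.Build _ _ _ _ w wL).
apply: eq_kern => y y'; rewrite kern_opk kern_sum -[w]/(w' : _ -> _).
under [RHS]eq_bigr do rewrite kernZ mulrC.
rewrite (_ : opk _ = \sum_(i | P i) kern (b i) y y' *: a i).
  by rewrite linear_sum; apply: eq_bigr => i _; rewrite linearZ.
apply: eq_kern => x x'; rewrite kern_opk !kern_sum.
by apply: eq_bigr => i _; rewrite kern_tens kernZ mulrC.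
Qed.

Lemma slicer_sum_tens (w : L2 C Y -> C^o) : linear w ->
  slicer w (\sum_(i | P i) tens (a i) (b i)) = \sum_(i | P i) w (b i) *: a i.
Proof.
move=> wL; pose w' : {linear _ -> _} := HB.pack w (GRing.isLinear.Build _ _ _ _ w wL).
apply: eq_kern => x x'; rewrite kern_opk kern_sum -[w]/(w' : _ -> _).
under [RHS]eq_bigr do rewrite kernZ mulrC.
rewrite (_ : opk _ = \sum_(i | P i) kern (a i) x x' *: b i).
  by rewrite linear_sum; apply: eq_bigr => i _; rewrite linearZ.
apply: eq_kern => y y'; rewrite kern_opk !kern_sum.
by apply: eq_bigr => i _; rewrite kern_tens kernZ.
Qed.

Lemma formtens_sum_tens (w : L2 C X -> C^o) (w' : L2 C Y -> C^o) :
  linear w -> linear w' ->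
  formtens w w' (\sum_(i | P i) tens (a i) (b i)) =
  \sum_(i | P i) w (a i) * w' (b i).
Proof.
move=> wL w'L; rewrite /formtens slicel_sum_tens //.
pose w2 : {linear _ -> _} := HB.pack w' (GRing.isLinear.Build _ _ _ _ w' w'L).
by rewrite -[w']/(w2 : _ -> _) linear_sum; apply: eq_bigr => i _; rewrite linearZ.
Qed.

End Slices.

Lemma formtens_tens X Y (w : L2 C X -> C^o) (w' : L2 C Y -> C^o) a b :
  linear w -> linear w' -> formtens w w' (tens a b) = w a * w' b.
Proof.
move=> wL w'L.
have := formtens_sum_tens (I := unit) predT (fun=> a) (fun=> b) wL w'L.
by rewrite !(big_pred1 tt) // => -[].
Qed.

Lemma slicel_linear X Y (w : L2 C X -> C^o) : linear w ->
  linear (slicel w : L2 C (X * Y) -> L2 C Y).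
Proof.
move=> wL c W W'; apply: eq_kern => y y'; rewrite kernP !kern_opk.
rewrite -[X in _ = X]wL -opk_linear; congr (w _).
by apply: eq_kern => x x'; rewrite !kern_opk kernP.
Qed.

Lemma slicer_linear X Y (w : L2 C Y -> C^o) : linear w ->
  linear (slicer w : L2 C (X * Y) -> L2 C X).
Proof.
move=> wL c W W'; apply: eq_kern => x x'; rewrite kernP !kern_opk.
rewrite -[X in _ = X]wL -opk_linear; congr (w _).
by apply: eq_kern => y y'; rewrite !kern_opk kernP.
Qed.

Lemma memv_vtens X Y (A : {vspace L2 C X}) (B : {vspace L2 C Y}) a b :
  a \in A -> b \in B -> tens a b \in vtens A B.
Proof.
move=> /coord_vbasis-> /coord_vbasis->; rewrite tens_suml rpred_sum // => i _.
rewrite tens_sumr rpred_sum // => j _; rewrite tensZl tensZr !rpredZ //.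
apply/memv_span/allpairsP; exists ((vbasis A)`_i, (vbasis B)`_j).
by rewrite !mem_nth ?size_tuple.
Qed.

End OperatorCalculus.

(** * Squares of a match pair *)

(** Inversion turns the factorizations in [H ** K] into factorizations in
    [K ** H].  Through this lemma every statement on vertical composition also
    yields its horizontal counterpart. *)
Lemma match_pairC (G : groupoid) (H K : {set G}) :
  match_pair H K -> match_pair K H.
Proof.
case=> HG KG HKe HKu; split=> // [g|g]; last by rewrite setIC; apply: HKu.
have [h [k [hH kK hk e]]] := HKe (ginv g).
exists (ginv k), (ginv h); split; rewrite ?HG.2 ?KG.2 ?src_inv ?rng_inv //.
by rewrite -ginvM // -e ginvK.
Qed.

Section Boxes.
Variables (G : groupoid) (H K : {set G}).
Hypothesis HK : match_pair H K.
Let KH := match_pairC HK.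

Local Notation lft := (p1 K H).
Local Notation bot := (p2 K H).
Local Notation top := (p1 H K).
Local Notation rgt := (p2 H K).

Lemma top_in g : top g \in H. Proof. by case: (factorP HK g). Qed.
Lemma rgt_in g : rgt g \in K. Proof. by case: (factorP HK g). Qed.
Lemma lft_in g : lft g \in K. Proof. by case: (factorP KH g). Qed.
Lemma bot_in g : bot g \in H. Proof. by case: (factorP KH g). Qed.

Lemma top_rgt g : g = top g ** rgt g. Proof. by case: (factorP HK g). Qed.
Lemma lft_bot g : g = lft g ** bot g. Proof. by case: (factorP KH g). Qed.

Lemma src_top g : src (top g) = mid H K g. Proof. by []. Qed.
Lemma src_lft g : src (lft g) = mid K H g. Proof. by []. Qed.
Lemma rng_rgt g : rng (rgt g) = mid H K g.
Proof. by case: (factorP HK g). Qed.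
Lemma rng_bot g : rng (bot g) = mid K H g.
Proof. by case: (factorP KH g). Qed.
Lemma rng_top g : rng (top g) = rng g.
Proof. by rewrite {2}(top_rgt g) rng_mul ?rng_rgt. Qed.
Lemma rng_lft g : rng (lft g) = rng g.
Proof. by rewrite {2}(lft_bot g) rng_mul ?rng_bot. Qed.
Lemma src_rgt g : src (rgt g) = src g.
Proof. by rewrite {2}(top_rgt g) src_mul ?rng_rgt. Qed.
Lemma src_bot g : src (bot g) = src g.
Proof. by rewrite {2}(lft_bot g) src_mul ?rng_bot. Qed.

(** The source or range of an edge is one of the four corners [rng g],
    [mid H K g], [mid K H g], [src g] of the square. *)
Definition corners :=
  (src_top, src_lft, rng_rgt, rng_bot, rng_top, rng_lft, src_rgt, src_bot).

Lemma subM_H x y : x \in H -> y \in H -> src x = rng y -> x ** y \in H.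
Proof. by case: HK => -[HM _] _ _ _; apply: HM. Qed.
Lemma subV_H x : x \in H -> ginv x \in H.
Proof. by case: HK => -[_ HV] _ _ _; apply: HV. Qed.
Lemma subM_K x y : x \in K -> y \in K -> src x = rng y -> x ** y \in K.
Proof. by case: HK => _ [KM _] _ _; apply: KM. Qed.
Lemma subV_K x : x \in K -> ginv x \in K.
Proof. by case: HK => _ [_ KV] _ _; apply: KV. Qed.

End Boxes.

(** A composability condition on a word in edges reduces to an equality between
    corners of squares, which follows from the hypotheses by congruence. *)
Ltac ends HK :=
  let KH := constr:(match_pairC HK) in
  solve [ repeat first
    [ progress rewrite ?(src_inv, rng_inv, src_unit, rng_unit, corners HK, corners KH)
    | rewrite src_mul; [|ends HK]
    | rewrite rng_mul; [|ends HK] ]; try congruence ].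

Ltac memb HK :=
  solve [ assumption
  | exact: (top_in HK) | exact: (rgt_in HK) | exact: (lft_in HK) | exact: (bot_in HK)
  | apply: (subV_H HK); memb HK | apply: (subV_K HK); memb HK
  | apply: (subM_H HK); [memb HK | memb HK | ends HK]
  | apply: (subM_K HK); [memb HK | memb HK | ends HK] ].

Ltac side HK := first [ends HK | memb HK | idtac].

Lemma gmulK (G : groupoid) (x y : G) : src x = rng y -> (x ** y) ** ginv y = x.
Proof. by move=> xy; rewrite -gmulA ?rng_inv // gmulVr -xy gmul1r. Qed.

Lemma ginv_unit (G : groupoid) (u : gobj G) : ginv (gunit u) = gunit u.
Proof.
apply/esym/ginv_eq; rewrite ?src_unit ?rng_unit //.
by rewrite -{1}(rng_unit u) gmul1l.
Qed.

Lemma gmulVKr (G : groupoid) (x y : G) :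
  src x = src y -> (x ** ginv y) ** y = x.
Proof. by move=> xy; rewrite -gmulA ?rng_inv ?src_inv // gmulVl -xy gmul1r. Qed.

Section Edges.
Variables (G : groupoid) (H K : {set G}).
Hypothesis HK : match_pair H K.
Let KH := match_pairC HK.

Local Notation lft := (p1 K H).
Local Notation bot := (p2 K H).
Local Notation top := (p1 H K).
Local Notation rgt := (p2 H K).

Ltac sd := side HK.

Lemma edges_lb k h : k \in K -> h \in H -> src k = rng h ->
  lft (k ** h) = k /\ bot (k ** h) = h.
Proof. by move=> kK hH kh; apply: (factor_unique KH). Qed.

Lemma edges_tr h k : h \in H -> k \in K -> src h = rng k ->
  top (h ** k) = h /\ rgt (h ** k) = k.
Proof. by move=> hH kK hk; apply: (factor_unique HK). Qed.

Lemma edgesP g k h h' k' :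
  k \in K -> h \in H -> h' \in H -> k' \in K -> src k = rng h ->
  src h' = rng k' -> g = k ** h -> g = h' ** k' ->
  [/\ lft g = k, bot g = h, top g = h' & rgt g = k'].
Proof.
move=> kK hH h'H k'K kh hk e e'.
have [lE bE] := edges_lb kK hH kh; have [tE rE] := edges_tr h'H k'K hk.
by rewrite -e in lE bE; rewrite -e' in tE rE.
Qed.

Lemma box_eq e f : lft e = lft f -> bot e = bot f -> e = f.
Proof. by move=> le be; rewrite (lft_bot HK e) le be -(lft_bot HK). Qed.

(** A unit factors into mutually inverse elements of [H] and [K], which lie in
    both subgroupoids, hence are units. *)
Lemma unit_in u : gunit u \in H /\ gunit u \in K.
Proof.
have [_ _ _ HKu] := HK.
have e := top_rgt HK (gunit u).
have ru : rng (top (gunit u)) = u by rewrite (rng_top HK) rng_unit.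
have rE : rgt (gunit u) = ginv (top (gunit u)).
  by apply: ginv_eq; rewrite ?rng_rgt // -e ru.
have tK : top (gunit u) \in K.
  by rewrite -[top _]ginvK -rE; sd.
have [|v vE] := HKu (top (gunit u)); first by rewrite inE (top_in HK).
suff uE : gunit u = top (gunit u) by split; rewrite uE; sd.
by rewrite vE -ru vE rng_unit.
Qed.

Lemma edges_H h : h \in H ->
  [/\ lft h = gunit (rng h), bot h = h, top h = h & rgt h = gunit (src h)].
Proof.
move=> hH; apply: edgesP; rewrite ?src_unit ?rng_unit ?gmul1l ?gmul1r //;
  exact: (unit_in _).2.
Qed.

Lemma edges_K k : k \in K ->
  [/\ lft k = k, bot k = gunit (src k), top k = gunit (rng k) & rgt k = k].
Proof.
move=> kK; apply: edgesP; rewrite ?src_unit ?rng_unit ?gmul1l ?gmul1r //;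
  exact: (unit_in _).1.
Qed.

Lemma in_K g : (g \in K) = (bot g == gunit (src g)).
Proof.
apply/idP/eqP => [/edges_K[_ -> _ _] //|bE].
rewrite (lft_bot HK g) bE (_ : src g = src (lft g)) ?gmul1r; sd.
by rewrite -(rng_unit (src g)) -bE; sd.
Qed.

Lemma vcorner e f : bot e = top f -> mid K H e = rng f /\ src e = mid H K f.
Proof.
by move=> ef; rewrite -(rng_bot HK) -(src_bot HK) ef (rng_top HK).
Qed.

Lemma vcomp_rgt e f : bot e = top f -> lft e ** f = e ** rgt f.
Proof.
move=> ef; have [c1 c2] := vcorner ef.
rewrite {1}(top_rgt HK f) -ef gmulA; sd.
by rewrite -(lft_bot HK).
Qed.

Lemma vcomp_edges e f : bot e = top f ->
  [/\ lft (lft e ** f) = lft e ** lft f, bot (lft e ** f) = bot f,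
      top (lft e ** f) = top e & rgt (lft e ** f) = rgt e ** rgt f].
Proof.
move=> ef; have [c1 c2] := vcorner ef.
apply: edgesP; sd.
  by rewrite -gmulA; sd; rewrite -(lft_bot HK).
by rewrite vcomp_rgt // gmulA; sd; rewrite -(top_rgt HK).
Qed.

Lemma vinv_alt g : ginv (lft g) ** top g = bot g ** ginv (rgt g).
Proof.
rewrite -[in LHS](@gmulK _ (top g) (rgt g)); sd.
rewrite -(top_rgt HK) [X in _ ** (X ** _)](lft_bot HK g) -gmulA ?gmulKV //; sd.
Qed.

Lemma vinv_edges g :
  [/\ lft (ginv (lft g) ** top g) = ginv (lft g),
      bot (ginv (lft g) ** top g) = top g,
      top (ginv (lft g) ** top g) = bot g
    & rgt (ginv (lft g) ** top g) = ginv (rgt g)].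
Proof. by apply: edgesP (vinv_alt g); sd. Qed.

Lemma inv_edges g :
  [/\ lft (ginv g) = ginv (rgt g), bot (ginv g) = ginv (top g),
      top (ginv g) = ginv (bot g) & rgt (ginv g) = ginv (lft g)].
Proof.
apply: edgesP; sd; rewrite -ginvM; sd; by rewrite -?(top_rgt HK) -?(lft_bot HK).
Qed.

Lemma hdiv_edges a g : lft a = lft g ->
  [/\ lft (ginv (top a) ** g) = rgt a,
      bot (ginv (top a) ** g) = ginv (bot a) ** bot g,
      top (ginv (top a) ** g) = ginv (top a) ** top g
    & rgt (ginv (top a) ** g) = rgt g].
Proof.
move=> ag; have c1 : rng a = rng g by rewrite -(rng_lft HK) ag (rng_lft HK).
have c2 : mid K H a = mid K H g by rewrite -src_lft ag.
have rE : ginv (top a) ** lft a = rgt a ** ginv (bot a).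
  by rewrite -[LHS]ginvK ginvM ?ginvK ?(vinv_alt a) ?ginvM ?ginvK //; sd.
apply: edgesP; sd.
  by rewrite {1}(lft_bot HK g) -ag gmulA; sd; rewrite rE -gmulA; sd.
by rewrite {1}(top_rgt HK g) gmulA; sd.
Qed.

Lemma hinv_alt a : ginv (top a) ** lft a = rgt a ** ginv (bot a).
Proof.
by rewrite -[LHS]ginvK ginvM ?ginvK ?(vinv_alt a) ?ginvM ?ginvK //; sd.
Qed.

Lemma vinv_inv g :
  ginv (lft (ginv g)) ** top (ginv g) = ginv (ginv (lft g) ** top g).
Proof.
by have [-> _ -> _] := inv_edges g; rewrite ginvK vinv_alt ginvM ?ginvK; sd.
Qed.

Lemma vinvK g : ginv (lft (ginv (lft g) ** top g)) ** top (ginv (lft g) ** top g) = g.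
Proof. by have [-> _ -> _] := vinv_edges g; rewrite ginvK -(lft_bot HK). Qed.

Lemma inv_vcomp e f : bot e = top f ->
  bot (ginv f) = top (ginv e) /\ lft (ginv f) ** ginv e = ginv (lft e ** f).
Proof.
move=> ef; have [c1 c2] := vcorner ef.
have [lf bf _ _] := inv_edges f; have [_ _ te _] := inv_edges e.
by split; rewrite ?bf ?te ?ef // lf vcomp_rgt // ginvM; sd.
Qed.

Lemma lft_corners a g : lft a = lft g ->
  rng a = rng g /\ mid K H a = mid K H g.
Proof.
by move=> ag; rewrite -(rng_lft HK) ag (rng_lft HK) -src_lft ag.
Qed.

(** Vertical inversion is a morphism for horizontal composition. *)
Lemma hdiv_vinv a g : lft a = lft g ->
  ginv (top (ginv (lft a) ** top a)) ** (ginv (lft g) ** top g) =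
  ginv (lft (ginv (top a) ** g)) ** top (ginv (top a) ** g).
Proof.
move=> ag; have [c1 c2] := lft_corners ag.
have [_ _ -> _] := vinv_edges a; rewrite !vinv_alt.
by have [_ -> _ ->] := hdiv_edges ag; rewrite gmulA; sd.
Qed.

(** If [g] is [a] followed by [f], then [ginv g] is [ginv f] followed by
    [ginv a]: inversion reverses horizontal composition. *)
Lemma hdiv_inv a g : lft a = lft g ->
  lft (ginv (ginv (top a) ** g)) = lft (ginv g) /\
  ginv (top (ginv (ginv (top a) ** g))) ** ginv g = ginv a.
Proof.
move=> ag; have [c1 c2] := lft_corners ag.
have [_ bE _ rE] := hdiv_edges ag.
have [-> _ tE _] := inv_edges (ginv (top a) ** g).
have [-> _ _ _] := inv_edges g; rewrite rE; split=> //.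
rewrite tE ginvK bE [X in _ ** ginv X](lft_bot HK g) ginvM; sd.
rewrite gmulA; sd; rewrite gmulK; sd.
by rewrite -ag -ginvM -?(lft_bot HK); sd.
Qed.

Lemma hcorner a c : lft c = rgt a -> mid H K a = rng c /\ src a = mid K H c.
Proof.
by move=> ca; rewrite -(rng_rgt HK) -(src_rgt HK) -ca (rng_lft HK).
Qed.

Lemma hcomp_edges a c : lft c = rgt a ->
  [/\ lft (top a ** c) = lft a, bot (top a ** c) = bot a ** bot c,
      top (top a ** c) = top a ** top c & rgt (top a ** c) = rgt c].
Proof.
move=> ca; have [c1 c2] := hcorner ca.
apply: edgesP; sd.
  rewrite {1}(lft_bot HK c) ca gmulA; sd.
  by rewrite -(top_rgt HK) gmulA; sd; rewrite -(lft_bot HK).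
by rewrite -gmulA; sd; rewrite -(top_rgt HK).
Qed.

Lemma hdivK a c : lft c = rgt a -> ginv (top a) ** (top a ** c) = c.
Proof. by move=> ca; have [c1 c2] := hcorner ca; rewrite gmulKV; sd. Qed.

Lemma hdivVK a e : lft a = lft e -> top a ** (ginv (top a) ** e) = e.
Proof. by move=> ae; have [c1 c2] := lft_corners ae; rewrite gmulVK; sd. Qed.

(** Removing [a] and then [c] is removing their horizontal composite. *)
Lemma hdiv_hcomp a c g : lft c = rgt a -> lft a = lft g ->
  ginv (top (top a ** c)) ** g = ginv (top c) ** (ginv (top a) ** g).
Proof.
move=> ca ag; have [c1 c2] := lft_corners ag.
have [_ _ -> _] := hcomp_edges ca.
have c3 : mid H K a = rng c by rewrite -(rng_lft HK) ca (rng_rgt HK).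
by rewrite ginvM ?gmulA; sd.
Qed.

Lemma lft_div k k' a : k \in K -> k' \in K -> src k = rng k' ->
  lft a = k ** k' -> lft (ginv k ** a) = k'.
Proof.
move=> kK k'K kk' lE.
have c : src k' = mid K H a by rewrite -src_lft lE; sd.
rewrite (lft_bot HK a) lE -gmulA ?gmulKV; sd.
by apply: (edges_lb _ _ _).1; sd.
Qed.

(** The vertical identities are the elements of [H]. *)
Lemma box_H a : lft a = gunit (rng a) -> a \in H.
Proof.
move=> lE; rewrite (lft_bot HK a) lE.
rewrite (_ : rng a = rng (bot a)) ?gmul1l; sd.
by rewrite -[LHS]src_unit -lE; sd.
Qed.

(** A horizontal splitting of a vertical composite restricts to splittings of
    the two factors.  Given [g] over [g'] and a left part [e'] of [g'], the
    square [e] filling the corner above [e'] is the matching left part of [g];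
    the left part of the composite is then [e] over [e'], and the right part is
    the right part of [g] over that of [g']. *)
Lemma box_interchange g g' e' (e := lft g ** top e') :
  bot g = top g' -> lft e' = lft g' ->
  [/\ lft e = lft g /\ bot e = top e',
      lft e ** e' = lft g ** e',
      lft (lft g ** e') = lft (lft g ** g'),
      bot (ginv (top e) ** g) = top (ginv (top e') ** g')
    & lft (ginv (top e) ** g) ** (ginv (top e') ** g') =
      ginv (top (lft g ** e')) ** (lft g ** g')].
Proof.
move=> gg' e'g'; have [c1 c2] := vcorner gg'; have [c3 c4] := lft_corners e'g'.
have [le be] : lft e = lft g /\ bot e = top e' by apply: edges_lb; sd.
have [l1 b1 t1 r1] := vcomp_edges be; rewrite le in l1 b1 t1 r1.
have [l2 _ _ _] := vcomp_edges gg'.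
have [_ _ t3 _] := hdiv_edges e'g'.
have [l4 b4 _ _] := hdiv_edges le.
rewrite le l1 l2 e'g' b4 t3 be gg' t1 l4; split=> //.
have [c5 c6] := vcorner be; have [c7 c8] := lft_corners le.
rewrite gmulA ?[RHS]gmulA; sd; congr (_ ** _).
by rewrite -be -hinv_alt -le.
Qed.

End Edges.

(** * Free families of operators *)

Section Frame.
Variables (C : numClosedFieldType) (B X : finType).
Variables (T : B -> L2 C X) (pt : B -> X * X).

(** Freeness in a computable form: the entry at [pt f] is the coordinate
    function of [T f]. *)
Definition framed : Prop :=
  forall e f, kern (T e) (pt f).1 (pt f).2 = (e == f)%:R.

Definition frame_span : {vspace L2 C X} := <<codom T>>%VS.

(** On the span of [T], the linear map sending each [T f] to [z f]. *)
Definition extend_fun (Z : vectType C) (z : B -> Z) (W : L2 C X) : Z :=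
  \sum_f kern W (pt f).1 (pt f).2 *: z f.

Fact extend_linear Z z : linear (@extend_fun Z z).
Proof.
move=> c W W'; rewrite /extend_fun scaler_sumr -big_split.
by apply: eq_bigr => f _; rewrite kernP scalerDl scalerA.
Qed.
HB.instance Definition _ (Z : vectType C) z :=
  GRing.isLinear.Build _ _ _ _ (@extend_fun Z z) (@extend_linear Z z).

Definition extend (Z : vectType C) (z : B -> Z) : 'Hom(L2 C X, Z) :=
  linfun (extend_fun z).

Lemma frame_in_span e : T e \in frame_span.
Proof. exact/memv_span/codom_f. Qed.

Hypothesis Tfr : framed.

Lemma extend_frame (Z : vectType C) (z : B -> Z) e : extend z (T e) = z e.
Proof.
rewrite lfunE /= /extend_fun (bigD1 e) //= Tfr eqxx scale1r.
by rewrite big1 ?addr0 // => f fe; rewrite Tfr eq_sym (negPf fe) scale0r.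
Qed.

Lemma frame_coord x : x \in frame_span ->
  x = \sum_f kern x (pt f).1 (pt f).2 *: T f.
Proof.
have sumT (a : B -> C) g :
    kern (\sum_f a f *: T f) (pt g).1 (pt g).2 = a g.
  rewrite kern_sum (bigD1 g) //= kernZ Tfr eqxx mulr1 big1 ?addr0 // => f fg.
  by rewrite kernZ Tfr (negPf fg) mulr0.
move=> xA; have [a ->] : exists a : B -> C, x = \sum_f a f *: T f.
  move/coord_span: xA => ->.
  elim/big_rec: _ => [|i y _ [a ->]].
    by exists (fun=> 0); rewrite big1 // => f _; rewrite scale0r.
  have /codomP[e ->] : (codom_tuple T)`_i \in codom T.
    by apply: mem_nth; rewrite size_codom.
  exists (fun f => coord (codom_tuple T) i x * (f == e)%:R + a f).
  under [RHS]eq_bigr do rewrite scalerDl.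
  rewrite big_split /=; congr (_ + _).
  rewrite (bigD1 e) //= eqxx mulr1 big1 ?addr0 // => f /negPf->.
  by rewrite mulr0 scale0r.
by apply: eq_bigr => f _; rewrite sumT.
Qed.

Lemma frame_eq (Z : lmodType C) (f g : L2 C X -> Z) :
  linear f -> linear g -> (forall e, f (T e) = g (T e)) ->
  {in frame_span, f =1 g}.
Proof.
move=> fL gL fg x /frame_coord->.
pose f' : {linear _ -> _} := HB.pack f (GRing.isLinear.Build _ _ _ _ f fL).
pose g' : {linear _ -> _} := HB.pack g (GRing.isLinear.Build _ _ _ _ g gL).
rewrite -[f]/(f' : _ -> _) -[g]/(g' : _ -> _) !linear_sum.
by apply: eq_bigr => e _; rewrite !linearZ /= fg.
Qed.

Lemma frame_eq2 (Z : lmodType C) (f g : L2 C X -> L2 C X -> Z) :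
  (forall y, linear (f^~ y)) -> (forall x, linear (f x)) ->
  (forall y, linear (g^~ y)) -> (forall x, linear (g x)) ->
  (forall d e, f (T d) (T e) = g (T d) (T e)) ->
  {in frame_span &, f =2 g}.
Proof.
move=> fL fR gL gR fg x y xA yA.
apply: (frame_eq (f := f^~ y) (g := g^~ y)) xA => // d.
by apply: frame_eq yA => // e.
Qed.

Lemma frame_mem (Z : vectType C) (V : {vspace Z}) (f : {linear L2 C X -> Z}) :
  (forall e, f (T e) \in V) -> {in frame_span, forall x, f x \in V}.
Proof.
move=> fV x /frame_coord->; rewrite linear_sum rpred_sum // => e _.
by rewrite linearZ rpredZ.
Qed.

End Frame.

Lemma comp_lfun_linearl (C : numClosedFieldType) (X : finType) (b : L2 C X) :
  linear (fun a : L2 C X => (a \o b)%VF).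
Proof. by move=> c a a'; rewrite comp_lfunDl comp_lfunZl. Qed.

Lemma comp_lfun_linearr (C : numClosedFieldType) (X : finType) (a : L2 C X) :
  linear (fun b : L2 C X => (a \o b)%VF).
Proof. by move=> c b b'; rewrite comp_lfunDr comp_lfunZr. Qed.

(** * Weak Hopf algebras spanned by squares *)

Section BoxRep.
Variables (C : numClosedFieldType) (G : groupoid) (H K : {set G}).
Hypothesis HK : match_pair H K.
Let KH := match_pairC HK.

Local Notation lft := (p1 K H).
Local Notation bot := (p2 K H).
Local Notation top := (p1 H K).
Local Notation rgt := (p2 H K).

Section Data.
Variables (X : finType) (T : G -> L2 C X) (pt : G -> X * X).

(** [T] is a faithful *-representation of the algebra of the vertical
    groupoid. *)
Record box_rep : Prop := BoxRep {
  br_pt : framed T pt;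
  br_mul : forall e f,
    (T e \o T f)%VF = if bot e == top f then T (lft e ** f) else 0;
  br_adj : forall e, adj (T e) = T (ginv (lft e) ** top e);
  br_one : \1%VF = \sum_(h in H) T h
}.

(** A horizontal factorization of [g] is determined by its left part [a], which
    is any square with the same left edge as [g]. *)
Definition box_cop (g : G) : L2 C (X * X) :=
  \sum_(a | lft a == lft g) tens (T a) (T (ginv (top a) ** g)).

Definition box_data : whopf_data C X :=
  WHopfData (extend pt box_cop) (extend pt (fun g => T (ginv g)))
    (extend pt (fun g => (g \in K)%:R : C^o)).

Local Notation A := (frame_span T).
Local Notation D := box_data.
Hypothesis TP : box_rep.
Let Tfr := br_pt TP.

Lemma copT g : cop D (T g) = box_cop g. Proof. exact: extend_frame. Qed.
Lemma antipT g : antip D (T g) = T (ginv g). Proof. exact: extend_frame. Qed.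
Lemma couT g : cou D (T g) = (g \in K)%:R. Proof. exact: extend_frame. Qed.

Lemma box_rep_cstar : cstar_subalgebra A.
Proof.
split=> [|a b aA bA|a].
- by rewrite (br_one TP) rpred_sum // => h _; apply: frame_in_span.
- rewrite (frame_coord Tfr aA) comp_suml rpred_sum // => e _.
  rewrite (frame_coord Tfr bA) comp_sumr rpred_sum // => f _.
  rewrite -comp_lfunZl -comp_lfunZr !rpredZ // (br_mul TP).
  by case: ifP => _; rewrite ?rpred0 // frame_in_span.
- move=> /(frame_coord Tfr)->; rewrite adj_sum rpred_sum // => e _.
  by rewrite adj_scale (br_adj TP) rpredZ ?frame_in_span.
Qed.

Lemma box_cop_in x : x \in A -> cop D x \in vtens A A.
Proof.
move: x; apply: (frame_mem Tfr) => e.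
rewrite -[X in X \in _]/(cop D (T e)) copT rpred_sum // => a _.
by rewrite memv_vtens ?frame_in_span.
Qed.

Lemma box_antip_in x : x \in A -> antip D x \in A.
Proof.
move: x; apply: (frame_mem Tfr) => e.
by rewrite -[X in X \in _]/(antip D (T e)) antipT frame_in_span.
Qed.

Lemma box_antip_mul : {in A &, forall x y,
  antip D (x \o y)%VF = (antip D y \o antip D x)%VF}.
Proof.
apply: (frame_eq2 Tfr) => [y|x|y|x|e f].
- by move=> c u v /=; rewrite comp_lfun_linearl linearP.
- by move=> c u v /=; rewrite comp_lfun_linearr linearP.
- by move=> c u v /=; rewrite linearP comp_lfun_linearr.
- by move=> c u v /=; rewrite linearP comp_lfun_linearl.
rewrite (br_mul TP) !antipT (br_mul TP).
have [_ bf _ _] := inv_edges HK f; have [_ _ te _] := inv_edges HK e.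
case: eqP => [ef|nef].
  by have [-> ->] := inv_vcomp HK ef; rewrite eqxx antipT.
rewrite linear0 bf te; case: eqP => // /(congr1 (@ginv G)).
by rewrite !ginvK => /esym.
Qed.

Lemma box_antip_adj : {in A, forall x, antip D (adj (antip D (adj x))) = x}.
Proof.
apply: (frame_eq Tfr) => [c u v|c u v //|e].
  by rewrite !(adjP, linearP) conjCK.
by rewrite (br_adj TP) antipT (br_adj TP) vinv_inv // antipT ginvK vinvK.
Qed.

Lemma box_cop_adj : {in A, forall x, cop D (adj x) = adj (cop D x)}.
Proof.
(* Both sides are antilinear; taking adjoints makes them linear, so that they
   can be compared on the basis. *)
move=> x xA; rewrite -[LHS](adj_adj).
congr (adj _); move: x xA.
apply: (frame_eq Tfr) => [c u v|c u v|e].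
- by rewrite !(adjP, linearP) conjCK.
- by rewrite linearP.
rewrite (br_adj TP) !copT /box_cop adj_sum.
rewrite (reindex (fun a => ginv (lft a) ** top a)) /=; last first.
  by exists (fun a => ginv (lft a) ** top a) => a _; apply: vinvK.
have E a : (lft (ginv (lft a) ** top a) == lft (ginv (lft e) ** top e)) =
   (lft a == lft e).
  have [-> _ _ _] := vinv_edges HK a; have [-> _ _ _] := vinv_edges HK e.
  by apply/eqP/eqP => [/(congr1 (@ginv G))|->//]; rewrite !ginvK.
rewrite (eq_bigl _ _ E); apply: eq_bigr => a /eqP ae.
by rewrite hdiv_vinv // adj_tens !(br_adj TP) !vinvK.
Qed.

Let copL : linear (cop D) := linearP (cop D).
Let antipL : linear (antip D) := linearP (antip D).
Let couL : linear (cou D) := linearP (cou D).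

Lemma box_antip_cop : {in A, forall x,
  maptens (antip D) (antip D) (cop D x) = flipop (cop D (antip D x))}.
Proof.
apply: (frame_eq Tfr) => [c u v|c u v|g].
- by rewrite copL maptens_linear.
- by rewrite antipL copL flipop_linear.
rewrite antipT !copT /box_cop maptens_sum flipop_sum.
have hE := @hdiv_inv _ _ _ HK.
pose h x a := ginv (ginv (top a) ** x).
have hK x a : lft a = lft x -> h (ginv x) (h x a) = a.
  by rewrite /h => /hE[_ ->]; rewrite ginvK.
have hl x a : lft a = lft x -> lft (h x a) = lft (ginv x).
  by rewrite /h => /hE[->].
rewrite [RHS](reindex_onto (h g) (h (ginv g))) /=; last first.
  by move=> a /eqP/hK; rewrite ginvK.
apply: eq_big => [a|a /eqP ae].
  apply/eqP/andP => [ae|[/eqP/hl + /eqP aE]]; last by rewrite aE ginvK.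
  by rewrite hK // hl.
by rewrite maptens_tens // flipop_tens !antipT; have [_ ->] := hE _ _ ae.
Qed.

(** In the product of the two coproducts only pairs of vertically composable
    left parts [e], [e'] survive.  Given [e'], the square [e] is determined by
    its left and bottom edges, and the interchange law makes [lft g ** e'] run
    over the left parts of the composite. *)
Lemma box_cop_mul : {in A &, forall x y,
  cop D (x \o y)%VF = (cop D x \o cop D y)%VF}.
Proof.
apply: (frame_eq2 Tfr) => [y|x|y|x|g g'].
- by move=> c u v /=; rewrite comp_lfun_linearl linearP.
- by move=> c u v /=; rewrite comp_lfun_linearr linearP.
- by move=> c u v /=; rewrite linearP comp_lfun_linearl.
- by move=> c u v /=; rewrite linearP comp_lfun_linearr.
rewrite (br_mul TP) !copT /box_cop comp_suml.
under [RHS]eq_bigr do rewrite comp_sumr.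
under [RHS]eq_bigr do under eq_bigr do rewrite tens_comp !(br_mul TP).
rewrite exchange_big /=.
case: eqP => [gg'|ngg']; last first.
  rewrite linear0 big1 // => e' /eqP e'g'; rewrite big1 // => e /eqP eg.
  case: eqP => [ee'|]; last by rewrite tens0l.
  have [_ -> _ _] := hdiv_edges HK eg; have [_ _ -> _] := hdiv_edges HK e'g'.
  case: eqP => [bb|]; last by rewrite tens0r.
  case: ngg'; have [c1 c2] := lft_corners HK eg.
  have [c3 c4] := lft_corners HK e'g'; have [c5 c6] := vcorner HK ee'.
  move: bb => /(congr1 (gmul (bot e))).
  by rewrite [in RHS]ee' !gmulVK; side HK.
rewrite copT /box_cop.
have [c1 c2] := vcorner HK gg'.
have [lu _ _ _] := vcomp_edges HK gg'.
rewrite (reindex_onto (fun e' => lft g ** e') (fun a => ginv (lft g) ** a)) /=; last first.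
  move=> a /eqP au; have [c3 c4] := lft_corners HK au.
  by rewrite rng_mul in c3; side HK; rewrite gmulVK; side HK.
have E e' : (lft (lft g ** e') == lft (lft g ** g')) &&
    (ginv (lft g) ** (lft g ** e') == e') = (lft e' == lft g').
  apply/andP/eqP => [[/eqP le /eqP <-]|e'g'].
    by apply: (lft_div HK _ _ _ (etrans le lu)); side HK.
  have [_ _ -> _ _] := box_interchange HK gg' e'g'; rewrite eqxx gmulKV //.
  by have [c3 _] := lft_corners HK e'g'; side HK.
rewrite (eq_bigl _ _ E); apply: eq_bigr => e' /eqP e'g'.
have [[le be] ve l1 bt v2] := box_interchange HK gg' e'g'.
set e := lft g ** top e' in le be ve bt v2.
rewrite (bigD1 e) ?le //= be eqxx bt eqxx v2.
rewrite big1 ?addr0 // => f /andP[/eqP fg fe].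
case: eqP => [bf|]; last by rewrite tens0l.
by case/eqP: fe; apply: (box_eq HK); rewrite ?le ?be.
Qed.

(** Both sides sum over the horizontal factorizations of [g] into three. *)
Lemma box_coassoc : {in A, forall x,
  assocop (maptens (cop D) id (cop D x)) = maptens id (cop D) (cop D x)}.
Proof.
apply: (frame_eq Tfr) => [c u v|c u v|g].
- by rewrite copL maptens_linear assocop_linear.
- by rewrite copL maptens_linear.
rewrite !copT /box_cop !maptens_sum assocop_sum /=.
under eq_bigr => e _ do
  rewrite maptens_tens // copT /box_cop tens_suml assocop_sum /=.
under [RHS]eq_bigr => e _ do
  rewrite maptens_tens // copT /box_cop tens_sumr /=.
rewrite (exchange_big_dep (fun a => lft a == lft g)) /=; last first.
  by move=> e a /eqP-> /eqP->.
apply: eq_bigr => a /eqP ag; have [lE bE tE rE] := hdiv_edges HK ag.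
rewrite (reindex_onto (fun c => top a ** c) (fun e => ginv (top a) ** e)) /=; last first.
  by move=> e /andP[/eqP eg _]; rewrite (hdivVK HK) // ag eg.
apply: eq_big => [c|c].
  apply/andP/eqP => [[/andP[/eqP cg /eqP ca] /eqP <-]|].
    by rewrite lE; have [->] := hdiv_edges HK ca.
  rewrite lE => ca; have [-> _ _ _] := hcomp_edges HK ca.
  by rewrite ag (hdivK HK ca) !eqxx.
case/andP=> /andP[/eqP cg /eqP ac] /eqP cE.
have ca : lft c = rgt a by rewrite -cE; have [->] := hdiv_edges HK ac.
by rewrite assocop_tens cE (hdiv_hcomp HK ca ag).
Qed.

(** The vertical identities are the elements of [H], and horizontal composition
    restricts on them to the product of [H]. *)
Lemma cop1 : cop D \1%VF =
  \sum_(x in H) \sum_(y in H | src x == rng y) tens (T x) (T y).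
Proof.
rewrite (br_one TP) (linear_sum (cop D)) /=.
under eq_bigr do rewrite copT /box_cop.
rewrite (exchange_big_dep (mem H)) /=; last first.
  move=> h a hH /eqP; have [-> _ _ _] := edges_H HK hH => la.
  by apply: (box_H HK); rewrite {1}la -[in RHS](rng_lft HK) la rng_unit.
apply: eq_bigr => x xH; have [lx _ tx _] := edges_H HK xH.
have rE h : h \in H -> lft x = lft h -> rng x = rng h.
  by move=> hH /(congr1 (@rng G)); rewrite !(rng_lft HK).
rewrite (reindex_onto (fun y => x ** y) (fun h => ginv x ** h)) /=; last first.
  by move=> h /andP[hH /eqP/(rE _ hH) e]; rewrite gmulVK.
rewrite tx; apply: eq_big => [y|y]; last by case/andP=> _ /eqP->.
apply/andP/andP => [[/andP[hH /eqP/(rE _ hH) e] /eqP <-]|[yH /eqP e]].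
  by rewrite rng_mul ?src_inv // rng_inv eqxx; split=> //; side HK.
have hH : x ** y \in H by side HK.
by have [-> _ _ _] := edges_H HK hH; rewrite hH lx rng_mul // gmulKV // !eqxx.
Qed.

(** The counit selects the factorization whose left part is the horizontal
    identity [lft g]. *)
Lemma box_coul : {in A, forall x, slicel (cou D) (cop D x) = x}.
Proof.
apply: (frame_eq Tfr) => [c u v|//|g].
  by rewrite copL slicel_linear.
rewrite copT slicel_sum_tens //.
under eq_bigr do rewrite couT.
have lK : lft g \in K by side HK.
have [ll _ tl _] := edges_K HK lK.
rewrite (bigD1 (lft g)) ?ll //= lK scale1r tl big1 ?addr0.
  by rewrite ginv_unit (rng_lft HK) gmul1l.
move=> a /andP[/eqP ag ne]; case: (boolP (a \in K)) => [aK|_]; last first.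
  by rewrite scale0r.
by case/eqP: ne; rewrite -ag; have [->] := edges_K HK aK.
Qed.

Lemma box_cour : {in A, forall x, slicer (cou D) (cop D x) = x}.
Proof.
apply: (frame_eq Tfr) => [c u v|//|g].
  by rewrite copL slicer_linear.
rewrite copT slicer_sum_tens //.
under eq_bigr do rewrite couT.
rewrite (bigD1 g) //= (_ : _ ** g = rgt g); last first.
  by rewrite {2}(top_rgt HK g) gmulKV; side HK.
rewrite (rgt_in HK) scale1r big1 ?addr0 // => a /andP[/eqP ag ne].
case: (boolP (_ \in K)) => [aK|_]; last by rewrite scale0r.
case/eqP: ne; apply: (box_eq HK) => //.
have [_ be _ _] := hdiv_edges HK ag; have [c1 c2] := lft_corners HK ag.
have [_ bk _ _] := edges_K HK aK; rewrite bk in be.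
have sE : src (bot a) = src (ginv (top a) ** g).
  by rewrite -[RHS]rng_unit be; side HK.
by rewrite -[LHS]gmul1r sE be gmulVK; side HK.
Qed.

(** If [f] and [lft e ** f] are horizontal identities then so is [e]. *)
Lemma cou_mulT e f :
  cou D (T e \o T f)%VF = [&& e \in K, f \in K & src e == rng f]%:R.
Proof.
rewrite (br_mul TP); case: eqP => [ef|nef].
  have [c1 c2] := vcorner HK ef; have [_ bE _ _] := vcomp_edges HK ef.
  rewrite couT (in_K HK (_ ** _)) bE src_mul; side HK; rewrite -(in_K HK).
  case: (boolP (f \in K)) => fK; last by rewrite andbF.
  have [_ _ tf _] := edges_K HK fK.
  have sE : src e = rng f by rewrite -(src_bot HK) ef tf src_unit.
  by rewrite (in_K HK e) ef tf sE !eqxx.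
rewrite linear0; case: and3P => // -[eK fK /eqP sE].
have [_ be _ _] := edges_K HK eK; have [_ _ tf _] := edges_K HK fK.
by case: nef; rewrite be tf sE.
Qed.

Lemma box_cou_mul : {in A &, forall x y,
  formtens (cou D) (cou D) (tens x \1 \o cop D \1 \o tens \1 y)%VF
    = cou D (x \o y)%VF}.
Proof.
apply: (frame_eq2 (Z := C^o) Tfr) => [y|x|y|x|e f].
- move=> c u v /=; rewrite tensl_linear 2!comp_lfun_linearl.
  by rewrite /formtens slicel_linear // couL.
- move=> c u v /=; rewrite tensr_linear comp_lfun_linearr.
  by rewrite /formtens slicel_linear // couL.
- by move=> c u v /=; rewrite comp_lfun_linearl couL.
- by move=> c u v /=; rewrite comp_lfun_linearr couL.
rewrite cop1 comp_sumr comp_suml.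
under eq_bigr do rewrite comp_sumr comp_suml.
under eq_bigr do under eq_bigr do
  rewrite !tens_comp comp_lfun1l comp_lfun1r !(br_mul TP).
rewrite cou_mulT.
transitivity (formtens (cou D) (cou D)
  (if src e == rng f then tens (T e) (T f) else 0)); last first.
  case: eqP => _; first by rewrite formtens_tens // !couT -natrM mulnb andbT.
  by rewrite -(tens0l _ 0) formtens_tens // linear0 mul0r !andbF.
congr formtens; rewrite (bigD1 (bot e)) /= ?(bot_in HK) //.
have [_ _ tb _] := edges_H HK (bot_in HK e).
rewrite [X in _ + X]big1 ?addr0; last first.
  move=> x /andP[xH ne]; rewrite big1 // => y _; have [_ _ -> _] := edges_H HK xH.
  by rewrite eq_sym (negPf ne) tens0l.
rewrite tb eqxx -(lft_bot HK) (src_bot HK).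
have yE y : y \in H -> bot y = y by move=> yH; have [] := edges_H HK yH.
case: eqP => [ef|nef]; last first.
  rewrite big1 // => y /andP[yH /eqP e1]; rewrite yE //.
  by case: eqP => [ye|_]; rewrite ?tens0r //; case: nef; rewrite e1 ye (rng_top HK).
have [lt _ _ _] := edges_H HK (top_in HK f).
rewrite (bigD1 (top f)) /= ?(top_in HK) ?(rng_top HK) ?ef ?eqxx //.
rewrite yE ?(top_in HK) // eqxx lt (rng_top HK) gmul1l big1 ?addr0 //.
by move=> y /andP[/andP[yH _] /negPf ne]; rewrite yE // ne tens0r.
Qed.

(** In a factorization of [g] into three, the product of the antipode of the
    first part with the second part vanishes unless these two parts cancel
    horizontally; it is then the vertical identity on the inverse of the bottom
    edge of the first part, and the third part is [g] itself. *)
Lemma box_antip_cancel : {in A, forall x,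
    maptens (fun W => multop (maptens (antip D) id W)) id
      (maptens (cop D) id (cop D x)) = (tens \1 x \o cop D \1)%VF}.
Proof.
have mL : linear (fun W => multop (maptens (antip D) id W)).
  by move=> c u v; rewrite maptens_linear multop_linear.
apply: (frame_eq Tfr) => [c u v|c u v|g].
- by rewrite copL !maptens_linear.
- by rewrite tensr_linear comp_lfun_linearl.
rewrite cop1 comp_sumr.
under [RHS]eq_bigr do rewrite comp_sumr.
under [RHS]eq_bigr do under eq_bigr do
  rewrite !tens_comp comp_lfun1l !(br_mul TP).
rewrite !copT /box_cop !maptens_sum /=.
under eq_bigr => e _.
  rewrite maptens_tens // copT /box_cop tens_suml maptens_sum /=.
  under eq_bigr => a _ do
    rewrite maptens_tens // maptens_tens // multop_tens antipT (br_mul TP).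
  over.
rewrite (exchange_big_dep (fun a => lft a == lft g)) /=; last first.
  by move=> e a /eqP-> /eqP->.
transitivity (\sum_(x in H | src x == rng (bot g)) tens (T x) (T g)); last first.
  rewrite big_mkcondr /=; apply: eq_bigr => x xH.
  have yE y : y \in H -> top y = y by move=> yH; have [] := edges_H HK yH.
  case: eqP => [sx|nsx]; last first.
    rewrite big1 // => y /andP[yH /eqP e1]; rewrite yE //.
    by case: eqP => [ye|_]; rewrite ?tens0r //; case: nsx; rewrite e1 ye.
  rewrite (bigD1 (bot g)) /= ?(bot_in HK) ?sx ?eqxx //.
  rewrite yE ?(bot_in HK) // eqxx -(lft_bot HK) big1 ?addr0 //.
  move=> y /andP[/andP[yH _] ne].
  by rewrite yE // eq_sym (negPf ne) tens0r.
rewrite [LHS](reindex_onto (fun x => lft g ** ginv x) (fun a => ginv (bot a))) /=; last first.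
  by move=> a /eqP ag; rewrite ginvK -ag -(lft_bot HK).
have E x : (lft (lft g ** ginv x) == lft g) && (ginv (bot (lft g ** ginv x)) == x)
   = (x \in H) && (src x == rng (bot g)).
  apply/andP/andP => [[/eqP/(lft_corners HK)[c1 c2] /eqP <-]|[xH /eqP sx]].
    by rewrite src_inv !(rng_bot HK) c2 eqxx; split=> //; side HK.
  have [-> ->] : lft (lft g ** ginv x) = lft g /\ bot (lft g ** ginv x) = ginv x.
    by apply: (edges_lb HK); rewrite ?rng_inv ?sx ?(rng_bot HK); side HK.
  by rewrite ginvK !eqxx.
rewrite (eq_bigl _ _ E); apply: eq_bigr => x; rewrite -E => /andP[/eqP ag /eqP xE].
set a := lft g ** ginv x in ag xE *.
have [ll bl tl rl] := edges_K HK (lft_in HK g).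
have [c1 c2] := lft_corners HK ag.
have al : lft a = lft (lft g) by rewrite ll.
have [_ _ td _] := hdiv_edges HK al; have [la ba _ _] := inv_edges HK a.
rewrite (bigD1 (lft g)) /= ?ll ?ag ?eqxx // ba td tl.
rewrite (_ : ginv (top a) ** gunit _ = ginv (top a)); last first.
  by rewrite (rng_lft HK) -c1 -(rng_top HK) -src_inv gmul1r.
rewrite eqxx la -ag (hinv_alt HK) ag gmulKV; side HK.
rewrite xE (rng_lft HK) ginv_unit gmul1l big1 ?addr0 //.
move=> e /andP[/andP[/eqP eg _] ne].
have ae : lft a = lft e by rewrite eg.
have [_ _ -> _] := hdiv_edges HK ae; case: eqP => [te|_]; last by rewrite tens0l.
have [c3 c4] := lft_corners HK ae.
case/eqP: ne; rewrite -eg.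
have eK : e \in K.
  apply: (box_H KH); move/(congr1 (gmul (top a))): te; rewrite gmulVr gmulVK; side HK.
by have [->] := edges_K HK eK.
Qed.

(** Only the coordinates on horizontal identities contribute.  With [s u] the sum
    of the coordinates over the [e] in [K] with range [u], the value is the sum
    of the squared moduli of the [s u]. *)
Lemma box_cou_pos : {in A, forall x, 0 <= cou D (adj x \o x)%VF}.
Proof.
move=> x /(frame_coord Tfr); set c := fun e => kern x (pt e).1 (pt e).2.
rewrite -/(c _) => xE.
have vK e : e \in K -> ginv (lft e) ** top e = ginv e.
  by move=> eK; have [-> _ -> _] := edges_K HK eK; rewrite -src_inv gmul1r.
have couE e f : cou D (adj (T e) \o T f)%VF =
    [&& e \in K, f \in K & rng e == rng f]%:R.
  rewrite (br_adj TP) cou_mulT.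
  have -> : (ginv (lft e) ** top e \in K) = (e \in K).
    apply/idP/idP => [eK|/[dup] eK /vK->]; last by side HK.
    by rewrite -(vinvK HK e) vK //; side HK.
  by case: (boolP (e \in K)) => // /vK->; rewrite src_inv.
pose s u := \sum_(e in K | rng e == u) c e.
suff -> : cou D (adj x \o x)%VF = \sum_u (s u)^* * s u.
  by apply: sumr_ge0 => u _; rewrite mulrC mul_conjC_ge0.
transitivity (\sum_(e in K) (c e)^* * s (rng e)); last first.
  rewrite (partition_big (@rng G) predT) //=; apply: eq_bigr => u _.
  rewrite {2}/s rmorph_sum mulr_suml; apply: eq_bigr => e /andP[_ /eqP->] //.
rewrite [in LHS]xE adj_sum comp_suml (linear_sum (cou D)) [RHS]big_mkcond /=.
apply: eq_bigr => e _.
rewrite comp_sumr (linear_sum (cou D)) /=.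
have E f : cou D (adj (c e *: T e) \o (c f *: T f))%VF =
    (c e)^* * (c f * [&& e \in K, f \in K & rng e == rng f]%:R).
  by rewrite adj_scale -comp_lfunZl -comp_lfunZr 2!linearZ /= couE.
under eq_bigr do rewrite E.
rewrite -mulr_sumr; case: ifP => eK; last first.
  by rewrite big1 ?mulr0 // => f _; rewrite mulr0.
rewrite /s [in RHS]big_mkcond /=; congr (_ * _); apply: eq_bigr => f _.
by rewrite eq_sym; case: ifP => _; rewrite ?mulr1 ?mulr0.
Qed.

Theorem box_weak_hopf : weak_hopf A D.
Proof.
split.
- exact: box_rep_cstar.
- exact: box_cop_in.
- exact: box_cop_mul.
- exact: box_cop_adj.
- exact: box_coassoc.
- exact: box_antip_in.
- exact: box_antip_mul.
- exact: box_antip_adj.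
- exact: box_antip_cop.
- exact: box_antip_cancel.
- exact: box_cou_pos.
- exact: box_coul.
- exact: box_cour.
- exact: box_cou_mul.
Qed.

End Data.
End BoxRep.

(** * Duality and transport *)

Section Duality.
Variables (C : numClosedFieldType) (G : groupoid) (H K : {set G}).
Hypothesis HK : match_pair H K.
Let KH := match_pairC HK.

Local Notation lft := (p1 K H).
Local Notation bot := (p2 K H).
Local Notation top := (p1 H K).

Definition box_pairing (X Y : finType) (pt : G -> X * X) (pt' : G -> Y * Y) :
    'Hom(L2 C X, linform C Y) :=
  extend pt (fun e => extend pt' (fun f => (e == f)%:R : C^o)).

Variables (X Y : finType) (T : G -> L2 C X) (pt : G -> X * X).
Variables (V : G -> L2 C Y) (pt' : G -> Y * Y).
Hypotheses (TP : box_rep H K T pt) (VP : box_rep K H V pt').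
Let Tfr := br_pt TP.
Let Vfr := br_pt VP.

Local Notation A := (frame_span T).
Local Notation B := (frame_span V).
Local Notation b := (box_pairing pt pt').

Lemma pairTV e f : b (T e) (V f) = (e == f)%:R.
Proof. by rewrite /box_pairing !extend_frame. Qed.

Let bL y : linear (b^~ y : L2 C X -> C^o).
Proof. by move=> c u v; rewrite linearP add_lfunE scale_lfunE. Qed.

Lemma pair_coordl f : {in A, forall x, b x (V f) = kern x (pt f).1 (pt f).2}.
Proof.
apply: (frame_eq (Z := C^o) Tfr) => [//|c u v|e]; first by rewrite kernP.
by rewrite Tfr pairTV.
Qed.

Lemma pair_coordr f : {in B, forall y, b (T f) y = kern y (pt' f).1 (pt' f).2}.
Proof.
apply: (frame_eq (Z := C^o) Vfr) => [|c u v|e]; first exact: linearP.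
  by rewrite kernP.
by rewrite Vfr pairTV eq_sym.
Qed.

Lemma pair_ndl : {in A, forall x, {in B, forall y, b x y = 0} -> x = 0}.
Proof.
move=> x xA bx0; rewrite (frame_coord Tfr xA) big1 // => f _.
by rewrite -pair_coordl // bx0 ?scale0r ?frame_in_span.
Qed.

Lemma pair_ndr : {in B, forall y, {in A, forall x, b x y = 0} -> y = 0}.
Proof.
move=> y yB by0; rewrite (frame_coord Vfr yB) big1 // => f _.
by rewrite -pair_coordr // by0 ?scale0r ?frame_in_span.
Qed.

(** The product of [T] is dual to the coproduct of [V], which splits [g]
    vertically: a factorization of [g] is determined by its upper part. *)
Lemma vcomp_eq e f g : (bot e == top f) && (lft e ** f == g) =
  (top e == top g) && (f == ginv (lft e) ** g).
Proof.
apply/andP/andP => -[/eqP e1 /eqP e2].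
  have [c1 c2] := vcorner HK e1; have [_ _ t1 _] := vcomp_edges HK e1.
  by rewrite -e2 t1 gmulKV ?eqxx //; side HK.
have [c1 c2] := lft_corners KH e1; have [t1 _ _ _] := hdiv_edges KH e1.
by rewrite e2 t1 gmulVK ?eqxx //; side HK.
Qed.

End Duality.

Section DualityTheorem.
Variables (C : numClosedFieldType) (G : groupoid) (H K : {set G}).
Hypothesis HK : match_pair H K.
Let KH := match_pairC HK.

Local Notation lft := (p1 K H).
Local Notation bot := (p2 K H).
Local Notation top := (p1 H K).
Local Notation rgt := (p2 H K).

Variables (X Y : finType) (T : G -> L2 C X) (pt : G -> X * X).
Variables (V : G -> L2 C Y) (pt' : G -> Y * Y).
Hypotheses (TP : box_rep H K T pt) (VP : box_rep K H V pt').
Let Tfr := br_pt TP.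
Let Vfr := br_pt VP.

Local Notation A := (frame_span T).
Local Notation B := (frame_span V).
Local Notation D := (box_data H K T pt).
Local Notation D' := (box_data K H V pt').
Local Notation b := (box_pairing C pt pt').

Let bL y : linear (b^~ y : L2 C X -> C^o).
Proof. by move=> c u v; rewrite linearP add_lfunE scale_lfunE. Qed.

Let bR x : linear (b x : L2 C Y -> C^o).
Proof. exact: linearP. Qed.

Let bTV := pairTV TP VP.


Let form2L (x' : L2 C X) (W : L2 C (Y * Y)) :
  linear (fun x => formtens (b x) (b x') W : C^o).
Proof.
move=> c u v; rewrite /formtens -(bR x'); congr (b x' _).
by apply: eq_kern => y y'; rewrite kernP !kern_opk bL.
Qed.

Let form2R (x : L2 C X) (W : L2 C (Y * Y)) :
  linear (fun x' => formtens (b x) (b x') W : C^o).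
Proof. by move=> c u v; rewrite /formtens bL. Qed.

Lemma pair_mull : {in A &, forall x x', {in B, forall y,
    b (x \o x')%VF y = formtens (b x) (b x') (cop D' y)}}.
Proof.
move=> x x' xA x'A y yB; move: x x' xA x'A.
apply: (frame_eq2 (Z := C^o) Tfr) => [x'|x|x'|x|e f].
- by move=> c u v /=; rewrite comp_lfun_linearl bL.
- by move=> c u v /=; rewrite comp_lfun_linearr bL.
- exact: form2L.
- exact: form2R.
move: y yB; apply: (frame_eq (Z := C^o) Vfr) => [||g]; first exact: bR.
  by move=> c u v; rewrite linearP /formtens slicel_linear // bR.
rewrite (copT VP) formtens_sum_tens // (br_mul TP).
under eq_bigr do rewrite !bTV.
transitivity (((bot e == top f) && (lft e ** f == g))%:R : C).
  by case: eqP; rewrite ?bTV ?linear0 ?zero_lfunE.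
rewrite vcomp_eq //; case: eqP => [eg|neg] /=.
  rewrite (bigD1 e) ?eg //= eqxx mul1r big1 ?addr0 // => a /andP[_ ae].
  by rewrite eq_sym (negPf ae) mul0r.
rewrite big1 // => a /eqP ag; case: eqP => [ea|]; last by rewrite mul0r.
by case: neg; rewrite ea.
Qed.

Let form1L (y' : L2 C Y) (W : L2 C (X * X)) :
  linear (fun y => formtens (b^~ y) (b^~ y') W : C^o).
Proof.
move=> c u v; rewrite /formtens -(bL y'); congr (b _ y').
by apply: eq_kern => x x'; rewrite kernP !kern_opk bR.
Qed.

Let form1R (y : L2 C Y) (W : L2 C (X * X)) :
  linear (fun y' => formtens (b^~ y) (b^~ y') W : C^o).
Proof. by move=> c u v; rewrite /formtens bR. Qed.

Lemma pair_mulr : {in A, forall x, {in B &, forall y y',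
    b x (y \o y')%VF = formtens (b^~ y) (b^~ y') (cop D x)}}.
Proof.
move=> x xA y y' yB y'B; move: y y' yB y'B.
apply: (frame_eq2 (Z := C^o) Vfr) => [y'|y|y'|y|e f].
- by move=> c u v /=; rewrite comp_lfun_linearl bR.
- by move=> c u v /=; rewrite comp_lfun_linearr bR.
- exact: form1L.
- exact: form1R.
move: x xA; apply: (frame_eq (Z := C^o) Tfr) => [||g]; first exact: bL.
  by move=> c u v; rewrite linearP /formtens slicel_linear // bL.
rewrite (copT TP) formtens_sum_tens // (br_mul VP).
under eq_bigr do rewrite !bTV.
transitivity (((rgt e == lft f) && (top e ** f == g))%:R : C).
  by case: eqP; rewrite ?bTV ?linear0 // eq_sym.
rewrite (vcomp_eq KH) //; case: eqP => [eg|neg] /=.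
  rewrite (bigD1 e) ?eg //= eqxx mul1r big1 ?addr0 // 1?eq_sym //.
  by move=> a /andP[_ ae]; rewrite (negPf ae) mul0r.
rewrite big1 // => a /eqP ag; case: eqP => [ea|]; last by rewrite mul0r.
by case: neg; rewrite -ea.
Qed.

Let sum_delta (Q : {set G}) e : \sum_(h in Q) (h == e)%:R = (e \in Q)%:R :> C.
Proof.
case: (boolP (e \in Q)) => eQ; last first.
  by rewrite big1 // => h hQ; case: eqP => // he; rewrite -he hQ in eQ.
rewrite (bigD1 e) //= eqxx big1 ?addr0 // => h /andP[_ /negPf->] //.
Qed.

Lemma pair_coul : {in A, forall x, b x \1%VF = cou D x}.
Proof.
apply: (frame_eq (Z := C^o) Tfr) => [//|//|e]; first exact: linearP.
rewrite (br_one VP) (linear_sum (b (T e))) (couT TP) -sum_delta.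
by apply: eq_bigr => f _; rewrite /= bTV eq_sym.
Qed.

Lemma pair_cour : {in B, forall y, b \1%VF y = cou D' y}.
Proof.
apply: (frame_eq (Z := C^o) Vfr) => [||f]; first exact: bR.
  exact: linearP.
rewrite (br_one TP) (linear_sum b) sum_lfunE (couT VP) -sum_delta.
by apply: eq_bigr => e _; rewrite /= bTV.
Qed.

Lemma pair_antip : {in A, forall x, {in B, forall y,
    b (antip D x) y = b x (antip D' y)}}.
Proof.
move=> x xA y yB; move: x xA.
apply: (frame_eq (Z := C^o) Tfr) => [c u v|//|e].
  by rewrite (linearP (antip D)) bL.
move: y yB; apply: (frame_eq (Z := C^o) Vfr) => [|c u v|f]; first exact: bR.
  by rewrite (linearP (antip D')) bR.
rewrite (antipT TP) (antipT VP) !bTV.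
by congr (nat_of_bool _)%:R; apply/eqP/eqP => [<-|->]; rewrite ginvK.
Qed.

(** Horizontal inversion composed with [ginv] is vertical inversion. *)
Lemma pair_adj : {in A, forall x, {in B, forall y,
    b (adj x) y = (b x (adj (antip D' y)))^*}}.
Proof.
move=> x xA y yB; rewrite -[LHS]conjCK; congr (_^*); move: x xA.
apply: (frame_eq (Z := C^o) Tfr) => [c u v|//|e].
  by rewrite adjP bL rmorphD rmorphM /= conjCK.
rewrite -[RHS]conjCK; congr (_^*).
move: y yB; apply: (frame_eq (Z := C^o) Vfr) => [|c u v|f]; first exact: bR.
  by rewrite (linearP (antip D')) adjP bR rmorphD rmorphM /= conjCK.
rewrite (br_adj TP) (antipT VP) (br_adj VP) !bTV conjC_nat.
have [-> _ -> _] := inv_edges HK f; rewrite ginvK -(vinv_alt HK).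
by congr (nat_of_bool _)%:R; apply/eqP/eqP => [<-|->]; rewrite (vinvK HK).
Qed.

Theorem box_duality : whopf_duality A D B D' b.
Proof.
split.
- exact: (pair_ndl TP VP).
- exact: (pair_ndr TP VP).
- exact: pair_mull.
- exact: pair_mulr.
- exact: pair_coul.
- exact: pair_cour.
- exact: pair_antip.
- exact: pair_adj.
Qed.

End DualityTheorem.

Section Transport.
Variables (C : numClosedFieldType) (G : groupoid) (H K : {set G}).
Variables (X Y : finType) (T : G -> L2 C X) (pt : G -> X * X).
Variables (V : G -> L2 C Y) (pt' : G -> Y * Y).
Hypotheses (TP : box_rep H K T pt) (VP : box_rep H K V pt').
Let Tfr := br_pt TP.
Let Vfr := br_pt VP.

Local Notation phi := (extend pt V).

Let phiL : linear phi := linearP phi.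

(** Two representations of the same groupoid algebra have the same structure
    constants. *)
Lemma box_star_isomorphism :
  star_isomorphism (frame_span T) (frame_span V) phi.
Proof.
split.
- rewrite limg_span; congr (<<_>>)%VS; rewrite /codom /image_mem -map_comp.
  by apply: eq_map => e /=; rewrite (extend_frame Tfr).
- have coord x : x \in frame_span T -> forall f,
      kern x (pt f).1 (pt f).2 = kern (phi x) (pt' f).1 (pt' f).2.
    move=> xA f; move: x xA; apply: (frame_eq (Z := C^o) Tfr) => [c u v|c u v|e].
    + by rewrite kernP.
    + by rewrite phiL kernP.
    by rewrite (extend_frame Tfr) Tfr Vfr.
  move=> x y xA yA xy; rewrite (frame_coord Tfr xA) (frame_coord Tfr yA).
  by apply: eq_bigr => f _; rewrite !coord // xy.
- apply: (frame_eq2 Tfr) => [y|x|y|x|e f].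
  + by move=> c u v /=; rewrite comp_lfun_linearl phiL.
  + by move=> c u v /=; rewrite comp_lfun_linearr phiL.
  + by move=> c u v /=; rewrite phiL comp_lfun_linearl.
  + by move=> c u v /=; rewrite phiL comp_lfun_linearr.
  rewrite (br_mul TP) !(extend_frame Tfr) (br_mul VP).
  by case: ifP => _; rewrite ?(extend_frame Tfr) ?linear0.
- move=> x xA; rewrite -[LHS]adj_adj; congr (adj _); move: x xA.
  apply: (frame_eq Tfr) => [c u v|//|e].
    by rewrite adjP phiL adjP conjCK.
  by rewrite (br_adj TP) !(extend_frame Tfr) -(br_adj VP) adj_adj.
Qed.

Lemma box_transport : whopf_transport (frame_span T)
  (box_data H K T pt) (box_data H K V pt') phi.
Proof.
have phiT e : phi (T e) = V e by exact: extend_frame.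
split.
- apply: (frame_eq Tfr) => [c u v|c u v|e].
  + by rewrite phiL linearP.
  + by rewrite (linearP (cop _)) maptens_linear.
  rewrite phiT (copT VP) (copT TP) maptens_sum.
  by apply: eq_bigr => a _; rewrite maptens_tens // !phiT.
- apply: (frame_eq Tfr) => [c u v|c u v|e].
  + by rewrite phiL linearP.
  + by rewrite (linearP (antip _)) phiL.
  by rewrite phiT (antipT VP) (antipT TP) phiT.
- apply: (frame_eq (Z := C^o) Tfr) => [c u v|c u v|e].
  + by rewrite phiL linearP.
  + by rewrite linearP.
  by rewrite phiT (couT VP) (couT TP).
Qed.

End Transport.

Lemma pair_transport (C : numClosedFieldType) (G : groupoid) (H K : {set G})
    (X Y X' Y' : finType) (T : G -> L2 C X) (V : G -> L2 C Y)
    (T' : G -> L2 C X') (V' : G -> L2 C Y')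
    (pT : G -> X * X) (pV : G -> Y * Y) (pT' : G -> X' * X') (pV' : G -> Y' * Y') :
  box_rep H K T pT -> box_rep K H V pV ->
  box_rep H K T' pT' -> box_rep K H V' pV' ->
  {in frame_span T & frame_span V, forall x y,
    box_pairing C pT' pV' (extend pT T' x) (extend pV V' y) =
    box_pairing C pT pV x y}.
Proof.
move=> TP VP TP' VP' x y xA yB; move: x xA.
apply: (frame_eq (Z := C^o) (br_pt TP)) => [c u v|c u v|e].
- by rewrite (linearP (extend pT T')) linearP add_lfunE scale_lfunE.
- by rewrite linearP add_lfunE scale_lfunE.
move: y yB; apply: (frame_eq (Z := C^o) (br_pt VP)) => [c u v|c u v|f].
- by rewrite (linearP (extend pV V')) linearP.
- by rewrite linearP.
rewrite (extend_frame (br_pt TP)) (extend_frame (br_pt VP)).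
by rewrite (pairTV TP' VP') (pairTV TP VP).
Qed.

(** * Partial translations *)

Section Pullbacks.
Variable C : numClosedFieldType.
Implicit Types X Y : finType.

(** The operator [f |-> f \o m], cut down to [P]. *)
Definition pull X (P : pred X) (m : X -> X) : L2 C X :=
  opk (fun x y => (P x && (y == m x))%:R).

Lemma kern_pull X (P : pred X) m x y :
  kern (pull P m) x y = (P x && (y == m x))%:R.
Proof. by rewrite kern_opk. Qed.

Lemma eq_pull X (P P' : pred X) m m' :
  P =1 P' -> (forall x, P x -> m x = m' x) -> pull P m = pull P' m'.
Proof.
move=> PP mm; apply: eq_kern => x y; rewrite !kern_pull -PP.
by case: (boolP (P x)) => //= /mm->.
Qed.

Lemma pull_comp X (P P' : pred X) m m' :
  (pull P m \o pull P' m')%VF =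
  pull (fun x => P x && P' (m x)) (fun x => m' (m x)).
Proof.
apply: eq_kern => x y; rewrite kern_comp (bigD1 (m x)) //= !kern_pull eqxx.
rewrite andbT -natrM mulnb andbA big1 ?addr0 // => z zx.
by rewrite kern_pull (negPf zx) andbF mul0r.
Qed.

Lemma pull_pred0 X m : pull (@pred0 X) m = 0.
Proof.
by apply: eq_kern => x y; rewrite kern_pull /kern zero_lfunE ffunE.
Qed.

Lemma pull1 X : pull (@predT X) id = \1%VF.
Proof. by apply: eq_kern => x y; rewrite kern_pull kern1 eq_sym. Qed.

Lemma tens_pull X Y (P : pred X) (P' : pred Y) m m' :
  tens (pull P m) (pull P' m') =
  pull (fun p : X * Y => P p.1 && P' p.2) (fun p => (m p.1, m' p.2)).
Proof.
apply: eq_kern => p q; rewrite kern_tens !kern_pull -natrM mulnb.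
by case: q => q1 q2; rewrite xpair_eqE andbACA.
Qed.

Lemma adj_pull X (P Q : pred X) m n :
  (forall x y, P x && (y == m x) = Q y && (x == n y)) ->
  adj (pull P m) = pull Q n.
Proof.
by move=> PQ; apply: eq_kern => x y; rewrite kern_adj !kern_pull PQ conjC_nat.
Qed.

Lemma sum_indicator (I : finType) (S B : pred I) (a0 : I) (b : bool) :
  (forall a, S a && B a = (a == a0) && b) ->
  \sum_(a | S a) (B a)%:R = b%:R :> C.
Proof.
move=> SB; rewrite (bigID (pred1 a0)) /= [X in _ + X]big1 ?addr0; last first.
  by move=> a /andP[Sa /negPf aa0]; have := SB a; rewrite Sa aa0 /= => ->.
case: (boolP (S a0)) => Sa0; have := SB a0; rewrite eqxx.
  rewrite Sa0 /= => <-; rewrite (big_pred1 a0) // => a.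
  by rewrite /=; case: (eqVneq a a0) => [->|]; rewrite ?andbF ?Sa0.
rewrite (negPf Sa0) /= => <-; rewrite big1 // => a /andP[Sa /eqP aa0].
by rewrite -aa0 Sa in Sa0.
Qed.

End Pullbacks.

(** * The multiplicative partial isometry *)

Section GroupoidOperators.
Variables (C : numClosedFieldType) (G : groupoid) (H K : {set G}).
Hypothesis HK : match_pair H K.
Let KH := match_pairC HK.

Local Notation lft := (p1 K H).
Local Notation bot := (p2 K H).
Local Notation top := (p1 H K).
Local Notation rgt := (p2 H K).
Local Notation mpi := (Defs.mpi C H K).

(** [lop g] sends [ket y], for [top y = bot g], to [ket (lft g ** y)]; it extends
    vertical composition with [g]. *)
Definition lop (g : G) : L2 C G :=
  pull C (fun y => top y == top g) (fun y => ginv (lft g) ** y).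
(** [rop g] sends [ket (x ** bot g)], for [rgt x = lft g], to [ket x]; on the row
    [x] it is horizontal composition with [g]. *)
Definition rop (g : G) : L2 C G :=
  pull C (fun x => rgt x == lft g) (fun x => x ** bot g).

Lemma box_eq_lt e f : lft e = lft f -> top e = top f -> e = f.
Proof. by move=> le te; rewrite -(vinvK HK e) le te vinvK. Qed.

Lemma vdiv_edges a g : top a = top g ->
  [/\ top (ginv (lft a) ** g) = bot a,
      rgt (ginv (lft a) ** g) = ginv (rgt a) ** rgt g,
      lft (ginv (lft a) ** g) = ginv (lft a) ** lft g
    & bot (ginv (lft a) ** g) = bot g].
Proof. exact: (hdiv_edges KH). Qed.

Lemma top_corners a g : top a = top g -> rng a = rng g /\ mid H K a = mid H K g.
Proof. exact: (lft_corners KH). Qed.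

(** Only the bottom edge of the right factor of a horizontal composite matters,
    so that composing with [e] is multiplying by [bot e]. *)
Lemma rmul_edges x e : rgt x = lft e ->
  [/\ x ** bot e = top x ** e, src x = mid K H e
    & rgt (x ** bot e) = rgt e /\ top (x ** bot e) = top x ** top e].
Proof.
move=> xe; have [c1 c2] := hcorner HK (esym xe).
have E : x ** bot e = top x ** e.
  by rewrite {1}(top_rgt HK x) xe -gmulA -?(lft_bot HK) //; side HK.
by have [_ _ t1 r1] := hcomp_edges HK (esym xe); rewrite E t1 r1.
Qed.

Lemma lop_box : box_rep H K lop (fun f => (f, bot f)).
Proof.
split=> [e f|e f|e|].
  (* The entry of [lop e] in row [f] and column [bot f] is nonzero only if [e]
     and [f] have the same top and left edges. *)
- rewrite kern_pull /=; congr (nat_of_bool _)%:R.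
  apply/andP/eqP => [[/eqP te /eqP be]|->]; last first.
    by rewrite eqxx [in X in _ ** X](lft_bot HK f) gmulKV //; side HK.
  have [c1 c2] := top_corners te.
  apply: box_eq_lt => //.
  have fE : f = lft e ** bot f by rewrite be gmulVK //; side HK.
  have cf : src (lft e) = rng (bot f) by rewrite be; side HK.
  by rewrite fE (edges_lb HK _ _ cf).1 //; side HK.
- rewrite pull_comp; case: eqP => [ef|nef]; last first.
    rewrite -(pull_pred0 C (fun y : G => ginv (lft f) ** (ginv (lft e) ** y))).
    apply: eq_pull => // y; apply/negP => /andP[/eqP/esym ye].
    by have [-> _ _ _] := vdiv_edges ye => /eqP.
  have [l1 _ t1 _] := vcomp_edges HK ef; have [c1 c2] := vcorner HK ef.
  apply: eq_pull => y.
    rewrite t1; case: eqP => // /esym ye.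
    by have [-> _ _ _] := vdiv_edges ye; rewrite ef eqxx.
  case/andP=> /eqP/top_corners[c3 c4] _.
  by rewrite l1 ginvM ?gmulA //; side HK.
- apply: adj_pull => x y; have [-> _ -> _] := vinv_edges HK e; rewrite ginvK.
  apply/andP/andP => -[/eqP e1 /eqP ->].
    have [c1 c2] := top_corners e1; have [-> _ _ _] := vdiv_edges (esym e1).
    by rewrite gmulVK ?eqxx //; side HK.
  have [c1 c2] := vcorner HK (esym e1).
  have [_ _ -> _] := vcomp_edges HK (esym e1).
  by rewrite gmulKV ?eqxx //; side HK.
- apply: eq_kern => x y; rewrite kern_sum kern1.
  under eq_bigr do rewrite kern_pull.
  apply/esym/(sum_indicator _ (a0 := top x)).
  move=> h; apply/andP/andP => [[hH /andP[/eqP tx /eqP ->]]|[/eqP -> /eqP ->]].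
    have [lh _ th _] := edges_H HK hH; rewrite tx th eqxx lh ginv_unit.
    by rewrite -th -tx (rng_top HK) gmul1l.
  have [lh _ th _] := edges_H HK (top_in HK y).
  by rewrite (top_in HK) lh th ginv_unit (rng_top HK) gmul1l !eqxx.
Qed.

Lemma rop_box : box_rep K H rop (fun f => (lft f, f)).
Proof.
split=> [e f|e f|e|].
- rewrite kern_pull /=; congr (nat_of_bool _)%:R.
  have [_ _ _ ->] := edges_K HK (lft_in HK f).
  apply/andP/eqP => [[/eqP le /eqP fE]|->]; last by rewrite -(lft_bot HK) !eqxx.
  by rewrite fE le -(lft_bot HK).
- rewrite pull_comp; case: eqP => [ef|nef]; last first.
    rewrite -(pull_pred0 C (fun x : G => x ** bot e ** bot f)).
    apply: eq_pull => // x; apply/negP => /andP[/eqP/rmul_edges[_ _ [-> _]]].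
    by move=> /eqP.
  have [l1 b1 _ _] := hcomp_edges HK (esym ef).
  have [c1 c2] := hcorner HK (esym ef).
  apply: eq_pull => x.
    rewrite l1; case: eqP => // /rmul_edges[_ _ [-> _]].
    by rewrite ef eqxx.
  case/andP=> /eqP/rmul_edges[_ c3 _] _.
  by rewrite b1 gmulA //; side HK.
- apply: adj_pull => x y.
  have [tv rv lv bv] := vinv_edges KH e; rewrite lv bv.
  apply/andP/andP => -[/eqP e1 /eqP ->].
    have [_ c1 [-> _]] := rmul_edges e1.
    by rewrite gmulK ?eqxx //; side HK.
  have [_ c1 [+ _]] := rmul_edges (etrans e1 (esym lv)).
  rewrite bv rv => ->; rewrite gmulVKr ?eqxx //.
  by rewrite -(src_rgt HK) e1; side HK.
- apply: eq_kern => x y; rewrite kern_sum kern1.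
  under eq_bigr do rewrite kern_pull.
  apply/esym/(sum_indicator _ (a0 := rgt x)).
  move=> k; apply/andP/andP => [[kK /andP[/eqP rx /eqP ->]]|[/eqP -> /eqP ->]].
    have [lk bk _ _] := edges_K HK kK; rewrite rx lk eqxx bk.
    by rewrite -lk -rx (src_rgt HK) gmul1r.
  have [lk bk _ _] := edges_K HK (rgt_in HK y).
  by rewrite (rgt_in HK) lk bk (src_rgt HK) gmul1r !eqxx.
Qed.

Lemma kern_mpi p q : kern mpi p q =
  ((mid H K p.1 == rng p.2) &&
   (q == (p.1 ** top (ginv (rgt p.1) ** p.2), ginv (rgt p.1) ** p.2)))%:R.
Proof.
rewrite /kern lfunE /= ffunE; case: ifP => // _.
by rewrite ffunE eq_sym.
Qed.

Lemma mpi_pull : mpi = pull C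
  (fun p => mid H K p.1 == rng p.2)
  (fun p => (p.1 ** top (ginv (rgt p.1) ** p.2), ginv (rgt p.1) ** p.2)).
Proof. by apply: eq_kern => p q; rewrite kern_mpi kern_pull. Qed.

Lemma adj_mpi_pull : adj mpi = pull C
  (fun p => src p.1 == mid H K p.2)
  (fun p => (p.1 ** ginv (top p.2), rgt (p.1 ** ginv (top p.2)) ** p.2)).
Proof.
rewrite mpi_pull; apply: adj_pull => -[x y] [x' y'] /=; rewrite !xpair_eqE.
apply/and3P/and3P => -[/eqP c /eqP e1 /eqP e2].
  rewrite e2 e1; have c1 : src x = rng (ginv (rgt x) ** y) by side HK.
  by rewrite src_mul ?gmulK ?gmulVK ?eqxx //; side HK.
have cx : src x = rng y' by rewrite e1; side HK.
rewrite e2 -e1 rng_mul ?gmulKV ?(rng_rgt HK) ?eqxx //; side HK.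
by rewrite e1 gmulVKr ?eqxx //; side HK.
Qed.

(** The square with left edge [k] and top edge [h], as the vertical inverse of
    the square with left edge [ginv k] and bottom edge [h]. *)
Definition box_lt (k h : G) : G :=
  ginv (lft (ginv k ** h)) ** top (ginv k ** h).

Lemma box_ltE k h : k \in K -> h \in H -> rng k = rng h ->
  lft (box_lt k h) = k /\ top (box_lt k h) = h.
Proof.
move=> kK hH kh; have [le be] : lft (ginv k ** h) = ginv k /\ bot (ginv k ** h) = h.
  by apply: (edges_lb HK); side HK.
by have [l1 _ t1 _] := vinv_edges HK (ginv k ** h); rewrite l1 t1 le be ginvK.
Qed.

Lemma act_edges k y (z := ginv k ** y) : k \in K -> rng k = rng y ->
  [/\ lft (k ** top z) = k, bot (k ** top z) = top z & top (k ** top z) = top y].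
Proof.
move=> kK ky; have [le be] : lft (k ** top z) = k /\ bot (k ** top z) = top z.
  by apply: (edges_lb HK); rewrite ?(rng_top HK) /z; side HK.
by have [_ _ + _] := vcomp_edges HK be; rewrite le {1}/z gmulVK.
Qed.

(** The row [(x, y)] of [I] is nonzero if [rgt x] and [top y] start at the same
    corner; they are then the left and top edges of one square [g], and only
    [V g ⊗ T g] contributes to this row. *)
Lemma mpi_sum : mpi = \sum_g tens (rop g) (lop g).
Proof.
apply: eq_kern => -[x y] [x' y']; rewrite kern_mpi kern_sum /=.
under eq_bigr do rewrite kern_tens !kern_pull -natrM mulnb.
set z := ginv (rgt x) ** y; apply/esym/(sum_indicator _ (a0 := rgt x ** top z)).
move=> g /=; rewrite xpair_eqE.
apply/andP/and3P => [[/andP[/eqP xg /eqP ->] /andP[/eqP yg /eqP ->]]|].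
  have [c1 c2] := top_corners yg; have [tz _ _ _] := vdiv_edges (esym yg).
  rewrite /z xg tz -(lft_bot HK) !eqxx; split=> //.
  by rewrite c1 -(rng_lft HK g) -xg (rng_rgt HK).
case=> /eqP-> /eqP c /andP[/eqP-> /eqP->].
have cr : rng (rgt x) = rng y by side HK.
by have [-> -> ->] := act_edges (rgt_in HK x) cr; rewrite !eqxx.
Qed.

Lemma lop_intertwine g : (mpi \o tens (lop g) \1 \o adj mpi)%VF = pull C
  (fun p => (mid H K p.1 == rng p.2) && (top p.1 ** top p.2 == top g))
  (fun p => (ginv (lft g) ** p.1,
             rgt (ginv (lft g) ** p.1) ** (ginv (rgt p.1) ** p.2))).
Proof.
rewrite adj_mpi_pull mpi_pull -(pull1 C) tens_pull !pull_comp.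
have tE x y (z := ginv (rgt x) ** y) : mid H K x = rng y ->
    top (x ** top z) = top x ** top y /\ src x = rng z.
  move=> c; have cr : rng (rgt x) = rng y by side HK.
  have [l1 b1 t1] := act_edges (rgt_in HK x) cr; rewrite -/z in l1 b1 t1.
  have [_ _ []] := rmul_edges (esym l1); rewrite b1 t1 => _ ->; split=> //.
  by rewrite /z; side HK.
have rE x y : mid H K x = rng y -> top x ** top y = top g -> rng x = rng g.
  by move=> c tg; rewrite -(rng_top HK g) -tg; side HK.
apply: eq_pull => -[x y] /=.
  case: eqP => //= c; have [-> cz] := tE _ _ c; case: eqP => //= tg.
  have cg := rE _ _ c tg; apply/eqP; set z := ginv (rgt x) ** y in cz *.
  by side HK.
case/andP=> /and3P[/eqP c /eqP tg _] _.
have [tz cz] := tE _ _ c; rewrite tz in tg; have cg := rE _ _ c tg.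
set z := ginv (rgt x) ** y in cz *.
have -> : ginv (lft g) ** (x ** top z) ** ginv (top z) = ginv (lft g) ** x.
  by rewrite gmulA ?gmulK //; side HK.
by [].
Qed.

Lemma rop_intertwine g : (adj mpi \o tens \1 (rop g) \o mpi)%VF = pull C
  (fun p => (src p.1 == mid H K p.2) && (rgt p.1 ** rgt p.2 == lft g))
  (fun p => (p.1 ** (ginv (top p.2) ** top (p.2 ** bot g)), p.2 ** bot g)).
Proof.
rewrite adj_mpi_pull mpi_pull -(pull1 C) tens_pull !pull_comp.
have rE x y (z := x ** ginv (top y)) : src x = mid H K y ->
    rgt (rgt z ** y) = rgt x ** rgt y /\ src z = rng y.
  move=> c; have cz : src z = rng y by rewrite /z; side HK.
  split=> //; set u := rgt z ** y.
  have cu : src (top z) = rng u by rewrite /u; side HK.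
  have zE : z ** y = (top z ** top u) ** rgt u.
    rewrite -gmulA -?(top_rgt HK) /u ?gmulA -?(top_rgt HK) //; side HK.
  have zE' : z ** y = top x ** (rgt x ** rgt y).
    rewrite gmulA -?(top_rgt HK); side HK.
    rewrite /z -gmulA; side HK; congr (_ ** _).
    by rewrite {2}(top_rgt HK y) gmulKV //; side HK.
  have <- : rgt (z ** y) = rgt u.
    by rewrite zE; apply: (edges_tr HK _ _ _).2; side HK.
  by rewrite zE'; apply: (edges_tr HK _ _ _).2; side HK.
have bE x y : rgt x ** rgt y = lft g -> src x = mid H K y -> src y = mid K H g.
  by move=> rg c; rewrite -src_lft -rg; side HK.
apply: eq_pull => -[x y] /=.
  case: eqP => //= c; have [-> cz] := rE _ _ c; case: eqP => //= rg.
  have cg := bE _ _ rg c; apply/eqP; set z := x ** ginv (top y) in cz *.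
  by side HK.
case/andP=> /andP[/eqP c /eqP rg] _.
have [rz cz] := rE _ _ c; rewrite rz in rg; have cg := bE _ _ rg c.
set z := x ** ginv (top y) in cz *.
have -> : ginv (rgt z) ** (rgt z ** y ** bot g) = y ** bot g.
  by rewrite -gmulA ?gmulKV //; side HK.
by rewrite /z -gmulA //; side HK.
Qed.

(** For a given row [(x, y)], the only left part of [g] that contributes to the
    coproduct has top edge [top x]. *)
Lemma lop_cop g :
  box_cop H K lop g = (mpi \o tens (lop g) \1 \o adj mpi)%VF.
Proof.
rewrite lop_intertwine; apply: eq_kern => -[x y] [x2 y2].
rewrite kern_sum kern_pull /=.
under eq_bigr do rewrite kern_tens !kern_pull -natrM mulnb.
apply: (sum_indicator _ (a0 := box_lt (lft g) (top x))) => a /=.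
rewrite xpair_eqE; apply/andP/and3P.
  case=> /eqP ag /andP[/andP[/eqP xa /eqP->] /andP[/eqP ya /eqP->]].
  have [lh _ th _] := hdiv_edges HK ag; have [c1 c2] := lft_corners HK ag.
  have [_ rv _ _] := vdiv_edges (esym xa); have [c3 c4] := top_corners xa.
  have c : mid H K x = rng y by rewrite -(rng_top HK y) ya; side HK.
  have c5 : rng (lft g) = rng (top x) by side HK.
  have [l0 t0] := box_ltE (lft_in HK g) (top_in HK x) c5.
  split; first by apply/eqP/box_eq_lt; rewrite ?l0 ?t0.
    by rewrite c ya th xa gmulVK ?eqxx //; side HK.
  rewrite -ag eqxx lh rv /= -gmulA ?gmulVK //; side HK.
case=> /eqP-> /andP[/eqP c /eqP tg] /andP[/eqP-> /eqP->].
have c5 : rng (lft g) = rng (top x).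
  by rewrite (rng_lft HK) -(rng_top HK) -tg; side HK.
have [l0 t0] := box_ltE (lft_in HK g) (top_in HK x) c5.
move: (box_lt _ _) l0 t0 => {}a l0 t0.
have [lh _ th _] := hdiv_edges HK l0; have [c3 c4] := top_corners t0.
have [_ rv _ _] := vdiv_edges t0.
rewrite lh th l0 t0 -tg gmulKV ?eqxx //=; side HK.
by rewrite -l0 rv -gmulA ?gmulVK ?eqxx //; side HK.
Qed.

(** For a given row [(x, y)], the only upper part of [g] that contributes to the
    coproduct has left edge [rgt x]. *)
Lemma rop_cop g :
  box_cop K H rop g = (adj mpi \o tens \1 (rop g) \o mpi)%VF.
Proof.
rewrite rop_intertwine; apply: eq_kern => -[x y] [x2 y2].
rewrite kern_sum kern_pull /=.
under eq_bigr do rewrite kern_tens !kern_pull -natrM mulnb.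
apply: (sum_indicator _ (a0 := box_lt (rgt x) (top g))) => a /=.
rewrite xpair_eqE; apply/andP/and3P.
  case=> /eqP ag /andP[/andP[/eqP xa /eqP->] /andP[/eqP ya /eqP->]].
  have [tv rv lv bv] := vdiv_edges ag; have [c1 c2] := top_corners ag.
  have c5 : rng (rgt x) = rng (top g) by rewrite xa; side HK.
  have [l0 t0] := box_ltE (rgt_in HK x) (top_in HK g) c5.
  have c : src x = mid H K y.
    by rewrite -(rng_rgt HK y) ya lv -(src_rgt HK x) xa; side HK.
  have [_ c3 [_ tm]] := rmul_edges ya.
  split; first by apply/eqP/box_eq_lt; rewrite ?l0 ?t0.
    by rewrite c ya lv xa gmulVK ?eqxx //; side HK.
  rewrite bv in tm; rewrite bv tm tv gmulKV ?eqxx //.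
  by rewrite src_top -c -(src_rgt HK x) xa; side HK.
case=> /eqP-> /andP[/eqP c /eqP rg] /andP[/eqP-> /eqP->].
have c5 : rng (rgt x) = rng (top g).
  by rewrite (rng_top HK) -(rng_lft HK g) -rg; side HK.
have [l0 t0] := box_ltE (rgt_in HK x) (top_in HK g) c5.
move: (box_lt _ _) l0 t0 => {}a l0 t0.
have [tv rv lv bv] := vdiv_edges t0; have [c1 c2] := top_corners t0.
have lvE : lft (ginv (lft a) ** g) = rgt y.
  by rewrite lv l0 -rg gmulKV //; side HK.
have [_ c3 [_ tm]] := rmul_edges (esym lvE); rewrite bv in tm.
rewrite lvE bv l0 t0 tm tv !eqxx gmulKV ?eqxx //.
by rewrite src_top -c -(src_rgt HK x) -l0; side HK.
Qed.

(** The adjoint of [V g] is [V] at the horizontal inverse of [g], and that of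
    [T g] is [T] at the vertical inverse; reindexing by the former turns the
    latter into [ginv g]. *)
Lemma adj_mpi_sum : adj mpi = \sum_g tens (rop g) (lop (ginv g)).
Proof.
rewrite mpi_sum adj_sum (reindex (fun g => ginv (top g) ** lft g)) /=; last first.
  by exists (fun g => ginv (top g) ** lft g) => g _; apply: (vinvK KH).
apply: eq_bigr => g _; rewrite adj_tens (br_adj rop_box) (vinvK KH).
have [tv rv lv bv] := vinv_edges KH g.
rewrite (br_adj lop_box) lv tv -ginvM -?(top_rgt HK) //; side HK.
Qed.

End GroupoidOperators.

(** * Slices of the partial isometry *)

Section Structures.
Variables (C : numClosedFieldType) (G : groupoid) (H K : {set G}).
Hypothesis HK : match_pair H K.

Local Notation lft := (p1 K H).
Local Notation bot := (p2 K H).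
Local Notation top := (p1 H K).
Local Notation rgt := (p2 H K).
Local Notation mpi := (Defs.mpi C H K).
Local Notation T := (lop C H K).
Local Notation V := (rop C H K).
Local Notation ptT := (fun g : G => (g, bot g)).
Local Notation ptV := (fun g : G => (lft g, g)).

Let TP := lop_box C HK.
Let VP := rop_box C HK.
Let Tfr := br_pt TP.
Let Vfr := br_pt VP.

Let formL (w : linform C G) : linear w. Proof. exact: linearP. Qed.

Lemma slicel_mpi (w : linform C G) : slicel w mpi = \sum_g w (V g) *: T g.
Proof. by rewrite mpi_sum // (slicel_sum_tens _ _ _ (formL w)). Qed.

Lemma slicer_mpi (w : linform C G) : slicer w mpi = \sum_g w (T g) *: V g.
Proof. by rewrite mpi_sum // (slicer_sum_tens _ _ _ (formL w)). Qed.

(** Freeness of [V] provides, for each [g], a form [w] with [slicel w] picking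
    [T g] out of [mpi_sum]. *)
Lemma algS_span : algS C H K = frame_span T.
Proof.
apply/eqP; rewrite eqEsubv; apply/andP; split.
  apply/subvP => x /memv_imgP[w _ ->]; rewrite lfunE /= /slicel_form slicel_mpi.
  by rewrite rpred_sum // => g _; rewrite rpredZ ?frame_in_span.
apply/span_subvP => _ /codomP[g ->].
pose w : linform C G := extend ptV (fun f => (f == g)%:R : C^o).
have -> : T g = linfun (slicel_form mpi) w; last by rewrite memv_img ?memvf.
rewrite lfunE /= /slicel_form slicel_mpi (bigD1 g) //= (extend_frame Vfr).
rewrite eqxx scale1r big1 ?addr0 // => f /negPf fg.
by rewrite (extend_frame Vfr) fg scale0r.
Qed.

Lemma algShat_span : algShat C H K = frame_span V.
Proof.
apply/eqP; rewrite eqEsubv; apply/andP; split.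
  apply/subvP => x /memv_imgP[w _ ->]; rewrite lfunE /= /slicer_form slicer_mpi.
  by rewrite rpred_sum // => g _; rewrite rpredZ ?frame_in_span.
apply/span_subvP => _ /codomP[g ->].
pose w : linform C G := extend ptT (fun f => (f == g)%:R : C^o).
have -> : V g = linfun (slicer_form mpi) w; last by rewrite memv_img ?memvf.
rewrite lfunE /= /slicer_form slicer_mpi (bigD1 g) //= (extend_frame Tfr).
rewrite eqxx scale1r big1 ?addr0 // => f /negPf fg.
by rewrite (extend_frame Tfr) fg scale0r.
Qed.

Lemma lop_structure : S_structure H K (box_data H K T ptT).
Proof.
split=> [|w|w].
- rewrite algS_span; apply: (frame_eq Tfr) => [|c u v|g]; first exact: linearP.
    by rewrite tensl_linear comp_lfun_linearr comp_lfun_linearl.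
  by rewrite (copT TP) lop_cop.
- rewrite slicel_mpi adj_mpi_sum // (slicel_sum_tens _ _ _ (formL w)).
  rewrite (linear_sum (antip _)) /=; apply: eq_bigr => g _.
  by rewrite linearZ /= (extend_frame Tfr).
- rewrite slicel_mpi (linear_sum (cou _)) (br_one VP) (linear_sum w) /=.
  rewrite [RHS]big_mkcond /=; apply: eq_bigr => g _.
  rewrite linearZ /= (extend_frame Tfr) /GRing.scale /=.
  by case: (g \in K); rewrite ?mulr1 ?mulr0.
Qed.

Lemma rop_structure : Shat_structure H K (box_data K H V ptV).
Proof.
split=> [|w|w].
- rewrite algShat_span; apply: (frame_eq Vfr) => [|c u v|g]; first exact: linearP.
    by rewrite tensr_linear comp_lfun_linearr comp_lfun_linearl.
  by rewrite (copT VP) rop_cop.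
- rewrite slicer_mpi adj_mpi_sum // (slicer_sum_tens _ _ _ (formL w)).
  rewrite (linear_sum (antip _)) /= [RHS](reindex_inj (inv_inj (@ginvK G))) /=.
  apply: eq_bigr => g _.
  by rewrite linearZ /= (extend_frame Vfr) ginvK.
- rewrite slicer_mpi (linear_sum (cou _)) (br_one TP) (linear_sum w) /=.
  rewrite [RHS]big_mkcond /=; apply: eq_bigr => g _.
  rewrite linearZ /= (extend_frame Vfr) /GRing.scale /=.
  by case: (g \in H); rewrite ?mulr1 ?mulr0.
Qed.

Lemma pairing_slices : S_pairing H K (box_pairing C ptT ptV).
Proof.
move=> w w'; rewrite slicel_mpi slicer_mpi mpi_sum //.
rewrite (formtens_sum_tens _ _ _ (formL w) (formL w')).
rewrite (linear_sum (box_pairing _ _ _)) sum_lfunE /=; apply: eq_bigr => g _.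
rewrite linearZ /= scale_lfunE /GRing.scale /=; congr (_ * _).
rewrite (linear_sum (box_pairing _ _ _ _)) (bigD1 g) //= linearZ /=.
rewrite (pairTV TP VP) eqxx big1 ?addr0 => [|f /negPf fg].
  by rewrite /GRing.scale /= mulr1.
by rewrite linearZ /= (pairTV TP VP) eq_sym fg scaler0.
Qed.

Lemma kern_alphal (n : {ffun gobj G -> C}) (S : L2 C G) x y :
  kern (alpha H K n \o S)%VF x y = n (mid H K x) * kern S x y.
Proof. by rewrite /kern comp_lfunE /= lfunE /= ffunE. Qed.

Lemma kern_alphar (n : {ffun gobj G -> C}) (S : L2 C G) x y :
  kern (S \o alpha H K n)%VF x y = n (mid H K y) * kern S x y.
Proof.
rewrite kern_comp (bigD1 y) //= big1 ?addr0 => [|z zy].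
  by rewrite {2}/kern lfunE /= !ffunE eqxx mulr1 mulrC.
by rewrite {2}/kern lfunE /= !ffunE (negPf zy) !mulr0.
Qed.

Lemma kern_flip_mpi p q : kern (flip C G \o mpi)%VF p q =
  ((mid H K p.2 == rng p.1) &&
   (q == (p.2 ** top (ginv (rgt p.2) ** p.1), ginv (rgt p.2) ** p.1)))%:R.
Proof.
rewrite kern_comp (bigD1 (p.2, p.1)) //= kern_opk eqxx mul1r kern_mpi.
by rewrite big1 ?addr0 // => z /negPf zp; rewrite kern_opk zp mul0r.
Qed.

Lemma mid_flip y y' : src y = rng y' ->
  mid H K (rgt y ** y') = mid H K (y ** top y').
Proof.
move=> c; have [l1 b1] : lft (rgt y ** top y') = rgt y /\
    bot (rgt y ** top y') = top y' by apply: (edges_lb HK); side HK.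
have [_ _ t1 _] := vcomp_edges HK b1; rewrite l1 in t1.
have [_ _ [_]] := rmul_edges HK (esym l1); rewrite b1 => t2.
by rewrite -!src_top t1 t2 src_mul //; side HK.
Qed.

(** The solution of [rgt y ** y' = u] and [y ** top y' = u'] in [y] and [y'].
    Both edges of the square [g = top u ** rgt u'] occur: [lft g] is the right
    edge of [y] and [bot g] the top edge of [y']. *)
Definition flip_row u u' := (top u' ** ginv (top u)) ** lft (top u ** rgt u').
Definition flip_col u u' :=
  bot (top u ** rgt u') ** (ginv (rgt u') ** rgt u).

Lemma flip_splitP u u' (y := flip_row u u') (y' := flip_col u u') :
  mid H K u = mid H K u' ->
  [/\ mid H K y = rng u, y ** top y' = u', rgt y ** y' = u & src y = rng y'].
Proof.
rewrite /y /y' /flip_row /flip_col => c; set g := top u ** rgt u'.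
have [tg rg] : top g = top u /\ rgt g = rgt u' by apply: (edges_tr HK); side HK.
have rgE : rng g = rng u by rewrite -(rng_top HK g) tg (rng_top HK).
have sgE : src g = src u' by rewrite -(src_rgt HK g) rg (src_rgt HK).
have [ty ry] : top (top u' ** ginv (top u) ** lft g) = top u' ** ginv (top u) /\
    rgt (top u' ** ginv (top u) ** lft g) = lft g.
  by apply: (edges_tr HK); side HK.
have [ty' ry'] : top (bot g ** (ginv (rgt u') ** rgt u)) = bot g /\
    rgt (bot g ** (ginv (rgt u') ** rgt u)) = ginv (rgt u') ** rgt u.
  by apply: (edges_tr HK); side HK.
split.
- by rewrite -src_top ty; side HK.
- rewrite ty' -gmulA -?(lft_bot HK) /g; side HK.
  rewrite -gmulA; side HK; rewrite gmulKV; side HK.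
  by rewrite -(top_rgt HK).
- rewrite ry gmulA -?(lft_bot HK); side HK.
  rewrite /g -gmulA; side HK; rewrite gmulVK; side HK.
  by rewrite -(top_rgt HK).
by side HK.
Qed.

(** Conversely, an operator commuting with [alpha(N)] is recovered as a slice by
    reading its entry at [(u, u')] from the entry of the variable at
    [(flip_row u u', flip_col u u')]. *)
Lemma mpi_regular : regular C H K.
Proof.
move=> S; split=> [[w SE] n|comm].
  apply: eq_kern => x x'; rewrite kern_alphal kern_alphar.
  case: (eqVneq (mid H K x') (mid H K x)) => [->//|ne].
  suff -> : kern S x x' = 0 by rewrite !mulr0.
  rewrite SE kern_opk; rewrite (_ : opk _ = 0) ?linear0 //.
  apply: eq_kern => y y'; rewrite kern_opk kern_flip_mpi /= xpair_eqE.
  rewrite [RHS](_ : _ = 0); last by rewrite /kern zero_lfunE ffunE.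
  case: and3P => // -[/eqP c /eqP e1 /eqP e2]; case/eqP: ne.
  have cy : src y = rng y' by rewrite e2; side HK.
  by rewrite e1 -e2 -mid_flip // e2 gmulVK //; side HK.
have S0 x x' : mid H K x != mid H K x' -> kern S x x' = 0.
  (* The indicator of [mid x] separates [x] from [x']. *)
  move=> ne; pose n : {ffun gobj G -> C} := [ffun u => (u == mid H K x)%:R].
  have /(congr1 (fun U => kern U x x')) := comm n.
  rewrite kern_alphal kern_alphar !ffunE eqxx mul1r eq_sym (negPf ne).
  by rewrite mul0r.
pose wf (M : L2 C G) : C^o := \sum_(u : G * G | mid H K u.1 == mid H K u.2)
  kern S u.1 u.2 * kern M (flip_row u.1 u.2) (flip_col u.1 u.2).
have wfL : linear wf.
  move=> c M N; rewrite /wf scaler_sumr -big_split; apply: eq_bigr => u _ /=.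
  by rewrite kernP mulrDr /GRing.scale /= mulrCA.
pose w' : {linear _ -> _} := HB.pack wf (GRing.isLinear.Build _ _ _ _ wf wfL).
exists (linfun w'); apply: eq_kern => x x'; rewrite kern_opk lfunE /= /wf.
have E u : mid H K u.1 == mid H K u.2 ->
    kern (opk (fun y y' => kern (flip C G \o mpi)%VF (x, y) (x', y')))
      (flip_row u.1 u.2) (flip_col u.1 u.2) = (u == (x, x'))%:R.
  case: u => u u' /= /eqP/flip_splitP.
  move: (flip_row u u') (flip_col u u') => y y' [e1 e2 e3 e4].
  rewrite kern_opk kern_flip_mpi /= xpair_eqE; congr (nat_of_bool _)%:R.
  apply/and3P/eqP => [[/eqP c /eqP d1 /eqP d2]|[<- <-]].
    have cy : rng (rgt y) = rng x by rewrite -c; side HK.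
    by congr (_, _); [rewrite -e3 d2 gmulVK | rewrite -e2 d1 -d2].
  by rewrite e1 -e3 gmulKV ?e2 ?eqxx //; side HK.
under eq_bigr => u uP do rewrite E //.
case: (eqVneq (mid H K x) (mid H K x')) => [xx|ne].
  rewrite (bigD1 (x, x')) ?xx //= eqxx mulr1 big1 ?addr0 // => u.
  by case/andP=> _ /negPf->; rewrite mulr0.
rewrite S0 // big1 // => u /eqP uP; case: eqP => [e|]; last by rewrite mulr0.
by case/eqP: ne; move: uP; rewrite e.
Qed.


End Structures.

Section Relabel.
Variables (C : numClosedFieldType) (G : groupoid) (H K : {set G}).
Variables (X Y : finType) (beta : Y -> X) (beta' : X -> Y).
Hypotheses (betaK : cancel beta beta') (betaK' : cancel beta' beta).

Definition relabel (S : L2 C X) : L2 C Y :=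
  opk (fun y y' => kern S (beta y) (beta y')).

Lemma relabel_box (T : G -> L2 C X) pt : box_rep H K T pt ->
  box_rep H K (relabel \o T) (fun g => (beta' (pt g).1, beta' (pt g).2)).
Proof.
case=> Tfr Tmul Tadj Tone; split=> [e f|e f|e|].
- by rewrite /= kern_opk !betaK' Tfr.
- have -> : (if p2 K H e == p1 H K f then (relabel \o T) (p1 K H e ** f) else 0)
    = relabel (if p2 K H e == p1 H K f then T (p1 K H e ** f) else 0).
    case: ifP => // _; apply: eq_kern => y y'.
    by rewrite kern_opk /kern !zero_lfunE !ffunE.
  rewrite -Tmul; apply: eq_kern => y y'; rewrite kern_opk !kern_comp.
  rewrite (reindex beta) /=; last by exists beta' => z _.
  by apply: eq_bigr => z _; rewrite !kern_opk.
- by apply: eq_kern => y y'; rewrite kern_adj /= !kern_opk -Tadj kern_adj.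
- apply: eq_kern => y y'; rewrite kern_sum kern1 -(can_eq betaK) -kern1 Tone.
  by rewrite kern_sum; apply: eq_bigr => h _; rewrite kern_opk.
Qed.

End Relabel.

(** [delta] only has to be onto, since the kets of its values then span. *)
Lemma limg_ket_span (C : numClosedFieldType) (B Y Z : finType)
    (L : {linear l2 C Y -> L2 C Z}) (T : B -> L2 C Z) (delta : B -> Y)
    (delta' : Y -> B) :
  cancel delta' delta -> (forall g, L (ket C (delta g)) = T g) ->
  limg (linfun L) = frame_span T.
Proof.
move=> dK LT; apply/eqP; rewrite eqEsubv; apply/andP; split.
  apply/subvP => x /memv_imgP[F _ ->]; rewrite lfunE /=.
  have -> : F = \sum_y F y *: ket C y.
    apply/ffunP => z; rewrite sum_ffunE (bigD1 z) //= !ffunE eqxx.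
    rewrite big1 ?addr0 => [|y yz]; first by rewrite /GRing.scale /= mulr1.
    by rewrite !ffunE eq_sym (negPf yz) scaler0.
  rewrite linear_sum rpred_sum // => y _; rewrite linearZ rpredZ //=.
  by rewrite -[y]dK LT frame_in_span.
apply/span_subvP => _ /codomP[g ->]; rewrite -LT.
by rewrite (_ : L _ = linfun L (ket C (delta g))) ?memv_img ?memvf // lfunE.
Qed.

(** * Crossed products *)

Section Crossed.
Variables (C : numClosedFieldType) (G : groupoid) (H K : {set G}).
Hypothesis HK : match_pair H K.

Local Notation lft := (p1 K H).
Local Notation bot := (p2 K H).
Local Notation top := (p1 H K).
Local Notation rgt := (p2 H K).

Fact hrs_subproof g : [&& bot g \in H, lft g \in K & rng (bot g) == src (lft g)].
Proof. by rewrite (bot_in HK) (lft_in HK) (rng_bot HK) eqxx. Qed.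
Definition hrs g : HrsK H K := exist _ (bot g, lft g) (hrs_subproof g).
Definition hrs_arrow (d : HrsK H K) : G := (val d).2 ** (val d).1.

Fact ksr_subproof g : [&& lft g \in K, bot g \in H & src (lft g) == rng (bot g)].
Proof. by rewrite (bot_in HK) (lft_in HK) (rng_bot HK) eqxx. Qed.
Definition ksr g : KsrH H K := exist _ (lft g, bot g) (ksr_subproof g).
Definition ksr_arrow (d : KsrH H K) : G := (val d).1 ** (val d).2.

Fact hrr_subproof g : [&& top g \in H, lft g \in K & rng (top g) == rng (lft g)].
Proof. by rewrite (top_in HK) (lft_in HK) (rng_top HK) (rng_lft HK) eqxx. Qed.
Definition hrr g : HrrK H K := exist _ (top g, lft g) (hrr_subproof g).
Definition hrr_arrow (d : HrrK H K) : G := box_lt H K (val d).2 (val d).1.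

Lemma hrsK : cancel hrs hrs_arrow.
Proof. by move=> g; rewrite /hrs_arrow /= -(lft_bot HK). Qed.

Lemma hrs_arrowK : cancel hrs_arrow hrs.
Proof.
case=> -[h k] dP; apply/val_inj; case/and3P: (dP) => /= hH kK /eqP hk.
by have [-> ->] := edges_lb HK kK hH (esym hk).
Qed.

Lemma ksrK : cancel ksr ksr_arrow.
Proof. by move=> g; rewrite /ksr_arrow /= -(lft_bot HK). Qed.

Lemma ksr_arrowK : cancel ksr_arrow ksr.
Proof.
case=> -[k h] dP; apply/val_inj; case/and3P: (dP) => /= kK hH /eqP kh.
by have [-> ->] := edges_lb HK kK hH kh.
Qed.

Lemma hrr_arrowK : cancel hrr_arrow hrr.
Proof.
case=> -[h k] dP; apply/val_inj; case/and3P: (dP) => /= hH kK /eqP hk.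
by have [-> ->] := box_ltE HK kK hH (esym hk).
Qed.

Local Notation T := (lop C H K).
Local Notation V := (rop C H K).

(** Seen through [k ** h], the action [k |> h] reads off a top edge and the
    second factor of the crossed product translates on the left by [lft g]. *)
Lemma Lgamma_ket g : Lgamma (ket C (hrr g)) = relabel hrs_arrow (T g).
Proof.
apply: eq_kern => d e; rewrite (Lgamma_kern HK) ext0_ket kern_opk kern_pull.
rewrite /hrs_arrow; move: (valP d) (valP e) => /=.
case: (val d) => h k; case: (val e) => h' k' /=.
case/and3P=> hH kK /eqP hk /and3P[h'H k'K /eqP hk'].
rewrite xpair_eqE -/(lact _ _ _ _) /lact.
rewrite -[if _ then _ else _](_ : ((h' == h) && ((top (k ** h) == top g) &&
  (k ** ginv k' == lft g)))%:R = _); last by case: eqP.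
congr (nat_of_bool _)%:R.
apply/and3P/andP => [[/eqP hE /eqP tg /eqP lg]|[/eqP tg /eqP e1]].
  subst h'; rewrite tg -lg ginvM ?ginvK; side HK.
  rewrite eqxx gmulA; side HK; rewrite gmulVKr ?eqxx //; side HK.
have c : rng g = rng k by rewrite -(rng_top HK) -tg; side HK.
have e2 : k' ** h' = (ginv (lft g) ** k) ** h by rewrite e1 gmulA //; side HK.
have cc : src (ginv (lft g) ** k) = rng h by side HK.
have [lE bE] := edges_lb HK k'K h'H (esym hk').
have [lE' bE'] : lft (k' ** h') = ginv (lft g) ** k /\ bot (k' ** h') = h.
  by rewrite e2; apply: (edges_lb HK) => //; side HK.
have hE : h' = h by rewrite -bE bE'.
have kE : k' = ginv (lft g) ** k by rewrite -lE lE'.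
rewrite hE kE tg !eqxx; split=> //.
by rewrite ginvM ?ginvK ?gmulVK //; side HK.
Qed.

(** Seen through [k ** h], the action [k <| h] reads off a right edge and the
    second factor of the crossed product translates on the right by [bot g]. *)
Lemma Rdelta_ket g : Rdelta (ket C (ksr g)) = relabel ksr_arrow (V g).
Proof.
apply: eq_kern => d e; rewrite (Rdelta_kern HK) ext0_ket kern_opk kern_pull.
rewrite /ksr_arrow; move: (valP d) (valP e) => /=.
case: (val d) => k h; case: (val e) => k' h' /=.
case/and3P=> kK hH /eqP kh /and3P[k'K h'H /eqP kh'].
rewrite xpair_eqE /ract.
rewrite -[if _ then _ else _](_ : ((k' == k) && ((rgt (k ** h) == lft g) &&
  (ginv h ** h' == bot g)))%:R = _); last by case: eqP.
congr (nat_of_bool _)%:R.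
apply/and3P/andP => [[/eqP kE /eqP rg /eqP bg]|[/eqP rg /eqP e1]].
  subst k'; rewrite rg -bg eqxx -gmulA ?gmulVK ?eqxx //; side HK.
have c : src h = mid K H g by rewrite -src_lft -rg; side HK.
have e2 : k' ** h' = k ** (h ** bot g) by rewrite e1 -gmulA //; side HK.
have cc : src k = rng (h ** bot g) by side HK.
have [lE bE] := edges_lb HK k'K h'H kh'.
have [lE' bE'] : lft (k' ** h') = k /\ bot (k' ** h') = h ** bot g.
  by rewrite e2; apply: (edges_lb HK) => //; side HK.
have kE : k' = k by rewrite -lE lE'.
have hE : h' = h ** bot g by rewrite -bE bE'.
by rewrite hE kE rg !eqxx gmulKV ?eqxx //; side HK.
Qed.

Lemma crossL_span : crossL C H K = frame_span (relabel hrs_arrow \o T).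
Proof. exact: (limg_ket_span hrr_arrowK) Lgamma_ket. Qed.

Lemma crossR_span : crossR C H K = frame_span (relabel ksr_arrow \o V).
Proof. exact: (limg_ket_span ksr_arrowK) Rdelta_ket. Qed.

End Crossed.

Theorem proposition4p2p2 (R : realType) (G : groupoid) (H K : {set G}) :
  match_pair H K ->
  regular R[i] H K /\
  exists (phi : 'Hom(L2 R[i] G, L2 R[i] (HrsK H K)))
         (psi : 'Hom(L2 R[i] G, L2 R[i] (KsrH H K))),
    [/\ star_isomorphism (algS R[i] H K) (crossL R[i] H K) phi,
        star_isomorphism (algShat R[i] H K) (crossR R[i] H K) psi
      & exists (D D' : whopf_data R[i] G) (b : 'Hom(L2 R[i] G, linform R[i] G)),
        [/\ S_structure H K D, Shat_structure H K D', S_pairing H K b,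
            [/\ weak_hopf (algS R[i] H K) D,
                weak_hopf (algShat R[i] H K) D'
              & whopf_duality (algS R[i] H K) D (algShat R[i] H K) D' b]
          & exists (E : whopf_data R[i] (HrsK H K))
                   (E' : whopf_data R[i] (KsrH H K))
                   (c : 'Hom(L2 R[i] (HrsK H K), linform R[i] (KsrH H K))),
            [/\ whopf_transport (algS R[i] H K) D E phi,
                whopf_transport (algShat R[i] H K) D' E' psi,
                {in algS R[i] H K & algShat R[i] H K,
                  forall x y, c (phi x) (psi y) = b x y},
                weak_hopf (crossL R[i] H K) E /\ weak_hopf (crossR R[i] H K) E'
              & whopf_duality (crossL R[i] H K) E (crossR R[i] H K) E' c]]].
Proof.
move=> HK; split; first exact: mpi_regular.
have KH := match_pairC HK.
have TP := lop_box R[i] HK; have VP := rop_box R[i] HK.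
have TP' := relabel_box (hrs_arrowK HK) (hrsK HK) TP.
have VP' := relabel_box (ksr_arrowK HK) (ksrK HK) VP.
rewrite !algS_span // !algShat_span // !crossL_span // !crossR_span //.
do 2!eexists; split; first exact: (box_star_isomorphism TP TP').
  exact: (box_star_isomorphism VP VP').
do 3!eexists; split; first exact: lop_structure.
- exact: rop_structure.
- exact: pairing_slices.
- split; [exact: (box_weak_hopf HK TP) | exact: (box_weak_hopf KH VP) |].
  exact: (box_duality HK TP VP).
do 3!eexists; split.
- exact: (box_transport TP TP').
- exact: (box_transport VP VP').
- exact: (pair_transport TP VP TP' VP').
- by split; [exact: (box_weak_hopf HK TP') | exact: (box_weak_hopf KH VP')].
exact: (box_duality HK TP' VP').
Qed.
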